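(* For every accuracy parameter $M>0$ there exist constants $\alpha(M)>0$ and $C(M)>0$, depending only on $M$, such that the following holds. Let $N\ge2$ be an integer, let $0<\tau<1$, let $f\in\mathbb{C}^N$ be a fixed signal, and let $\Omega\subseteq\mathbb{Z}_N$ be the random set of frequencies obtained by including each $k\in\mathbb{Z}_N$ independently with probability $\tau$. Put $T=\{t\in\mathbb{Z}_N: f(t)\ne f(t-1)\}$ and suppose that $$|T|\le\alpha(M)\cdot(\log N)^{-1}\cdot\tau N.$$ Then with probability at least $1-C(M)N^{-M}$ the minimizer of the problem $$\min_{g\in\mathbb{C}^N}\ \sum_{t\in\mathbb{Z}_N}|g(t)-g(t-1)|\quad\text{subject to}\quad \hat g(k)=\hat f(k)\ \text{ for all }k\in\Omega\cup\{0\}$$ is unique and is equal to $f$.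
   Context: $\mathbb{Z}_N=\{0,\dots,N-1\}$, and the cyclic convention $g(-1)=g(N-1)$ (likewise for $f$) is used. For $f\in\mathbb{C}^N$ the discrete Fourier transform is $\hat f(k)=\sum_{t=0}^{N-1}f(t)e^{-2\pi i kt/N}$, $k\in\mathbb{Z}_N$. $|T|$ denotes the cardinality of $T$. *)

(* Defs.v *)
From HB Require Import structures.
From mathcomp Require Export all_boot all_order all_algebra.
From mathcomp Require Export all_classical all_reals all_analysis.
From mathcomp Require Export complex.

Set Implicit Arguments.
Unset Strict Implicit.
Unset Printing Implicit Defensive.
Import Order.TTheory GRing.Theory Num.Theory.
Import numFieldNormedType.Exports.
Local Open Scope classical_set_scope.
Local Open Scope ring_scope.

Section Signals.
Variables (R : realType) (N : nat).
Implicit Types (f g : {ffun 'I_N -> R[i]}) (k t : 'I_N) (S : {set 'I_N}).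

Definition expi (x : R) : R[i] := Complex (cos x) (sin x).

Definition dft f k : R[i] :=
  \sum_t f t * expi (- (2 * pi * k%:R * t%:R / N%:R)).

(* [ord_pred] is the cyclic predecessor: it sends 0 to N - 1. *)
Definition jump_set f : {set 'I_N} := [set t | f t != f (ord_pred t)]%SET.

Definition total_variation f : R :=
  \sum_t ComplexField.Normc.normc (f t - f (ord_pred t)).

Definition feasible f S g : Prop :=
  forall k, k \in S \/ k = 0%N :> nat -> dft g k = dft f k.

Definition tv_minimizer f S g : Prop :=
  feasible f S g /\
  forall h, feasible f S h -> total_variation g <= total_variation h.

Definition tv_exact_recovery f S : Prop :=
  forall g, tv_minimizer f S g <-> g = f.

End Signals.

Section RandomSets.
Context {d : measure_display} {T : measurableType d} {R : realType}.
Variable P : probability T R.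

Definition mutually_independent (I : finType) (E : I -> set T) : Prop :=
  forall A : {set I},
    P (\bigcap_(i in [set` A]) E i) = (\prod_(i in A) P (E i))%E.

Definition bernoulli_random_set (I : finType) (tau : R)
    (Omega : T -> {set I}) : Prop :=
  let E k := [set w | k \in Omega w] in
  [/\ forall k, measurable (E k),
      forall k, P (E k) = tau%:E
    & mutually_independent E].

End RandomSets.

(* Main.v *)
Require Import Defs.
From mathcomp Require Import ring lra.
Import Order.TTheory GRing.Theory Num.Theory.
Import numFieldNormedType.Exports.
Set Implicit Arguments.
Unset Strict Implicit.
Unset Printing Implicit Defensive.
Local Open Scope classical_set_scope.
Local Open Scope ring_scope.

(* The differences of a competitor and of [f] agree at the frequencies in
   [Omega], so the claim is l1 recovery of the jump vector of [f], supported on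
   [T].  It follows by duality from vectors in the span of the exponentials with
   frequency in [Omega] that are close to a prescribed vector [q] on [T] and at
   most 1/4 off [T]: [q] = sign of the jumps gives the descent inequality, and
   the unit vectors [q] = e_j replace a lower bound on the singular values of
   the restricted Fourier matrix.

   Such a vector is built by golfing.  [Omega] has the law of a union of about
   log N independent Bernoulli sets (batches), each with just a large constant
   times |T| expected elements.  A batch A gives an unbiased estimate of the
   residual [q]; a fraction of it is added to the certificate when the estimate
   is good in l2 on [T] (by Chebyshev, with probability close to 1), and A is
   skipped otherwise.  If the residual has norm [r * sqrt |T|], the fraction is
   min (1, 1 / (lam r)) with lam ~ log N.  Then exp (lam (+- v_j + r / 8)) is a
   supermartingale off [T], which gives the bound 1/4 there, and
   exp (3 lam r) r^2 shrinks by 3/4 in mean at each batch, which makes the final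
   residual polynomially small.  Both failures have probability N^-M once
   lam ~ M log N, without the extra logarithm of a golfing scheme that needs
   each batch to succeed with high probability. *)

(** * Means over Bernoulli random sets *)

Section BernoulliMean.
Variables (R : realType) (I : finType).
Implicit Types (p : R) (S A B : {set I}) (F G : {set I} -> R) (x : I -> R).

Definition bweight p S : R := \prod_i (if i \in S then p else 1 - p).

Definition bmean p F : R := \sum_(S : {set I}) bweight p S * F S.

Lemma bweight_ge0 p S : 0 <= p <= 1 -> 0 <= bweight p S.
Proof.
move=> /andP[p0 p1]; apply: prodr_ge0 => i _; case: ifP => // _.
by rewrite subr_ge0.
Qed.

Lemma le_bmean p F G : 0 <= p <= 1 -> (forall S, F S <= G S) ->
  bmean p F <= bmean p G.
Proof.
by move=> p01 FG; apply: ler_sum => S _; rewrite ler_wpM2l// bweight_ge0.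
Qed.

Lemma eq_bmean p F G : F =1 G -> bmean p F = bmean p G.
Proof. by move=> FG; apply: eq_bigr => S _; rewrite FG. Qed.

Lemma bmeanD p F G : bmean p (fun S => F S + G S) = bmean p F + bmean p G.
Proof. by rewrite -big_split; apply: eq_bigr => S _; rewrite mulrDr. Qed.

Lemma bmeanZ p (c : R) F : bmean p (fun S => c * F S) = c * bmean p F.
Proof. by rewrite mulr_sumr; apply: eq_bigr => S _; rewrite mulrCA. Qed.

Lemma bmean_sum p (K : finType) (Q : pred K) (F : K -> {set I} -> R) :
  bmean p (fun S => \sum_(k | Q k) F k S) = \sum_(k | Q k) bmean p (F k).
Proof.
rewrite /bmean exchange_big; apply: eq_bigr => S _.
by rewrite mulr_sumr.
Qed.

(** Independence enters here: expanding the product on the right by distributivity gives one term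
    per subset. Second moments, exponential moments and the law of a union all reduce to this
    formula. *)
Lemma bmean_prod p (a b : I -> R) :
  bmean p (fun S => \prod_i (if i \in S then a i else b i)) =
  \prod_i (p * a i + (1 - p) * b i).
Proof.
rewrite bigA_distr; apply: eq_bigr => S _; rewrite -big_split.
by apply: eq_bigr => i _ /=; case: ifP.
Qed.

Lemma bmean_cst p (c : R) : bmean p (fun=> c) = c.
Proof.
transitivity (c * bmean p (fun S => \prod_i (if i \in S then 1 else 1))).
  rewrite -bmeanZ; apply: eq_bmean => S; rewrite big1 ?mulr1// => i _.
  by case: ifP.
by rewrite bmean_prod big1 ?mulr1 => // i _; ring.
Qed.

(** An element escapes [A :|: B] exactly when it escapes both sets, which has weight
    [(1 - p) * (1 - q)]. This lets batches be split off the random set one at a time. *)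
Lemma bmean_setU p q F :
  bmean p (fun A => bmean q (fun B => F (A :|: B))) =
  bmean (1 - (1 - p) * (1 - q)) F.
Proof.
(* The indicator factors over the elements. The test [i \in B] is outermost, so that [bmean_prod]
   applies to [B] with [A] fixed, and then to [A]. *)
have indE A B S : ((A :|: B == S)%:R : R) =
    \prod_i (if i \in B then (i \in S)%:R else ((i \in A) == (i \in S))%:R).
  have [<-|/eqP nS] := eqVneq.
    rewrite big1// => i _; rewrite inE; case: (i \in B); first by rewrite orbT.
    by rewrite orbF eqxx.
  apply/esym/eqP; rewrite prodf_seq_eq0.
  have [i iS] : exists i, (i \in A :|: B) != (i \in S).
    apply: contra_notP nS => /forallNP nS; apply/setP => i.
    by apply/eqP; have := nS i; case: eqVneq.
  apply/hasP; exists i; first by rewrite mem_index_enum.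
  move: iS; rewrite inE /=.
  by case: (i \in A); case: (i \in B); case: (i \in S) => //=; rewrite eqxx.
have weightE S : bmean p (fun A => bmean q (fun B => (A :|: B == S)%:R)) =
    bweight (1 - (1 - p) * (1 - q)) S.
  transitivity (bmean p (fun A => \prod_i (if i \in A then (i \in S)%:R
      else q * (i \in S)%:R + (1 - q) * (i \notin S)%:R : R))).
    apply: eq_bmean => A.
    rewrite -[RHS](_ : \prod_i (q * (i \in S)%:R + (1 - q) * ((i \in A) == (i \in S))%:R) = _).
      by rewrite -bmean_prod; apply: eq_bmean => B; rewrite indE.
    apply: eq_bigr => i _.
    by case: (i \in A); case: (i \in S) => /=; rewrite ?eqxx; ring.
  rewrite bmean_prod; apply: eq_bigr => i _.
  by case: (i \in S) => /=; ring.
transitivity (\sum_S bmean p (fun A => bmean q (fun B => F S * (A :|: B == S)%:R))).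
  rewrite -bmean_sum; apply: eq_bmean => A.
  rewrite -bmean_sum; apply: eq_bmean => B.
  rewrite (bigD1 (A :|: B))//= eqxx mulr1 big1 ?addr0// => S.
  by rewrite eq_sym => /negbTE ->; rewrite mulr0.
apply: eq_bigr => S _; rewrite -weightE mulrC -bmeanZ; apply: eq_bmean => A.
by rewrite -bmeanZ.
Qed.

Definition selsum x S : R := \sum_(i in S) x i.

Lemma selsumE x S : selsum x S = \sum_i x i * (i \in S)%:R.
Proof.
rewrite /selsum big_mkcond; apply: eq_bigr => i _.
by case: (i \in S); rewrite ?mulr1 ?mulr0.
Qed.

Lemma bmean_mem2 p i j :
  bmean p (fun S => (i \in S)%:R * (j \in S)%:R) =
  p ^+ 2 + (p - p ^+ 2) * (i == j)%:R.
Proof.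
(* The indicator as a product: an index [k] in [S] contributes 1, and one outside [S] contributes 0
   exactly when it is [i] or [j]. *)
transitivity (\prod_k (p * 1 + (1 - p) * ((k != i) && (k != j))%:R)).
  rewrite -bmean_prod; apply: eq_bmean => S.
  have [iS|iS] := boolP (i \in S); last first.
    by rewrite mul0r (bigD1 i)//= (negbTE iS) eqxx mul0r.
  have [jS|jS] := boolP (j \in S); last first.
    by rewrite mulr0 (bigD1 j)//= (negbTE jS) eqxx andbF mul0r.
  rewrite mulr1 big1// => k _; case: ifPn => // kS.
  have -> : k != i by apply: contraNneq kS => ->.
  by have -> : k != j by apply: contraNneq kS => ->.
rewrite (bigD1 i)//= eqxx /=.
have [<-|ij] := eqVneq i j.
  rewrite big1 => [|k ki]; last by rewrite ki /=; ring.
  by rewrite /=; ring.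
rewrite (bigD1 j)/= 1?eq_sym//= eqxx andbF big1 => [|k /andP[ki kj]].
  by rewrite /=; ring.
by rewrite ki kj /=; ring.
Qed.

Lemma bmean_selsum p x : bmean p (selsum x) = p * \sum_i x i.
Proof.
transitivity (\sum_i x i * bmean p (fun S => (i \in S)%:R * (i \in S)%:R)).
  under eq_bigr do rewrite -bmeanZ; rewrite -bmean_sum.
  apply: eq_bmean => S; rewrite selsumE; apply: eq_bigr => i _.
  by rewrite -natrM mulnb andbb.
rewrite mulr_sumr; apply: eq_bigr => i _.
by rewrite bmean_mem2 eqxx mulr1; ring.
Qed.

Lemma bmean_selsum_sqr p x :
  bmean p (fun S => selsum x S ^+ 2) =
  (p * \sum_i x i) ^+ 2 + (p - p ^+ 2) * \sum_i x i ^+ 2.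
Proof.
transitivity (\sum_i \sum_j x i * x j *
    bmean p (fun S => (i \in S)%:R * (j \in S)%:R)).
  under eq_bigr do under eq_bigr do rewrite -bmeanZ.
  under eq_bigr do rewrite -bmean_sum; rewrite -bmean_sum.
  apply: eq_bmean => S; rewrite expr2 !selsumE mulr_suml.
  apply: eq_bigr => i _; rewrite mulr_sumr; apply: eq_bigr => j _.
  by rewrite mulrACA.
under eq_bigr do under eq_bigr do rewrite bmean_mem2 mulrDr.
under eq_bigr do rewrite big_split /=.
rewrite big_split /=; congr +%R.
  rewrite exprMn [X in _ * X]expr2 mulr_suml mulr_sumr; apply: eq_bigr => i _.
  by rewrite !mulr_sumr; apply: eq_bigr => j _; ring.
rewrite mulr_sumr; apply: eq_bigr => i _.
rewrite (bigD1 i)//= eqxx mulr1 big1 => [|j]; first by ring.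
by rewrite eq_sym => /negbTE ->; rewrite !mulr0.
Qed.

Lemma bmean_selsum_var p x (m : R) : p * \sum_i x i = m ->
  bmean p (fun S => (selsum x S - m) ^+ 2) <= p * \sum_i x i ^+ 2.
Proof.
move=> mE.
have -> : bmean p (fun S => (selsum x S - m) ^+ 2) =
    bmean p (fun S => selsum x S ^+ 2) - 2 * m * bmean p (selsum x) + m ^+ 2.
  rewrite -(bmean_cst p (m ^+ 2)) -mulNr -bmeanZ -!bmeanD.
  by apply: eq_bmean => S; ring.
rewrite bmean_selsum bmean_selsum_sqr mE -subr_ge0.
rewrite (_ : _ - _ = p ^+ 2 * \sum_i x i ^+ 2); last by ring.
by rewrite mulr_ge0 ?sqr_ge0// sumr_ge0// => i _; rewrite sqr_ge0.
Qed.

Lemma bmean_expR_selsum p x :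
  bmean p (fun S => expR (selsum x S)) =
  \prod_i (1 + p * (expR (x i) - 1)).
Proof.
transitivity (\prod_i (p * expR (x i) + (1 - p) * 1)).
  rewrite -bmean_prod; apply: eq_bmean => S.
  rewrite /selsum expR_sum big_mkcond.
  by apply: eq_bigr => i _; case: ifP.
by apply: eq_bigr => i _; ring.
Qed.

End BernoulliMean.

(** * Law of the random set of frequencies *)

Section LawOfRandomSet.
Context {d : measure_display} {T : measurableType d} {R : realType}.
Variables (P : probability T R) (I : finType) (tau : R) (Omega : T -> {set I}).
Hypothesis OmegaP : bernoulli_random_set P tau Omega.

(** The independence hypothesis only gives the probability of containing [A]. The elements to avoid
    are listed in [s], so that they can be imposed one at a time by induction. *)
Let cell (A : {set I}) (s : seq I) : set T :=
  [set w | A \subset Omega w /\ (forall i, i \in s -> i \notin Omega w)].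

Let cell0 A : cell A [::] = \bigcap_(i in [set` A]) [set w | i \in Omega w].
Proof.
apply/seteqP; split=> w /=; first by move=> [/fintype.subsetP Aw _] i; exact: Aw.
by move=> Aw; split=> //; apply/fintype.subsetP => i; exact: Aw.
Qed.

Let cell_cons A i s : cell A (i :: s) = cell A s `\` cell (i |: A) s.
Proof.
apply/seteqP; split=> w /=.
  move=> [Aw sw]; have iw : i \notin Omega w by apply: sw; rewrite mem_head.
  split; first by split=> // j js; apply: sw; rewrite in_cons js orbT.
  by move=> [/fintype.subsetP/(_ i)]; rewrite !inE eqxx (negbTE iw) => /(_ isT).
move=> [[Aw sw] nw]; split=> // j; rewrite in_cons => /orP[/eqP ->|]; last exact: sw.
apply/negP => iw; apply: nw; split=> //.
by rewrite finset.subUset finset.sub1set iw.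
Qed.

Let measurable_cell A s : measurable (cell A s).
Proof.
have [mE _ _] := OmegaP; elim: s A => [|i s IHs] A.
  rewrite cell0; apply: fin_bigcap_measurable => [|i _]; last exact: mE.
  exact: finite_finset.
by rewrite cell_cons; apply: measurableD.
Qed.

(** By [cell_cons], avoiding one more element subtracts the probability of containing it, which
    multiplies the value by [1 - tau]. *)
Let prob_cell (A : {set I}) s : uniq s -> (forall i, i \in s -> i \notin A) ->
  P (cell A s) = (tau ^+ #|A| * (1 - tau) ^+ size s)%:E.
Proof.
have [mE PE indE] := OmegaP; elim: s A => [|i s IHs] A.
  move=> _ _; rewrite cell0 indE; under eq_bigr do rewrite PE.
  by rewrite prodEFin prodr_const mulr1.
move=> /= /andP[nis us] sA; rewrite cell_cons.
have -> : P (cell A s `\` cell (i |: A) s) = (P (cell A s) - P (cell (i |: A) s))%E.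
  rewrite measureD//; last by rewrite ltey_eq fin_num_measure.
  rewrite setIidr// => w [iAw sw]; split=> //.
  by apply: fintype.subset_trans iAw; exact: finset.subsetUr.
have sA' j : j \in s -> j \notin A by move=> js; apply: sA; rewrite in_cons js orbT.
rewrite !IHs//; last first.
  move=> j js; rewrite !inE negb_or sA' // andbT.
  by apply: contraNneq nis => <-.
rewrite -EFinB cardsU1 sA ?mem_head//=; congr EFin.
by rewrite add1n !exprS; ring.
Qed.

Let bweightE (S : {set I}) : bweight tau S = tau ^+ #|S| * (1 - tau) ^+ size (enum (~: S)).
Proof.
rewrite /bweight (bigID (mem S)) /=; congr *%R.
  by rewrite (eq_bigr (fun=> tau)) ?prodr_const// => i ->.
rewrite (eq_bigr (fun=> 1 - tau)); last by move=> i /negbTE ->.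
rewrite -cardE -prodr_const; apply: eq_bigl => i; by rewrite inE.
Qed.

(** The event is a finite disjoint union of the atoms [Omega w = S]; each is the cell that contains
    [S] and avoids its complement. *)
Lemma prob_random_set (Q : {set I} -> Prop) :
  P [set w | Q (Omega w)] = (bmean tau (fun S => `[< Q S >]%:R))%:E.
Proof.
pose s := [seq S <- enum {set I} | `[< Q S >]].
have cellE (S : {set I}) : cell S (enum (~: S)) = [set w | Omega w = S].
  apply/seteqP; split=> w /=; last first.
    by move=> <-; split=> // i; rewrite mem_enum inE.
  move=> [Sw Swc]; apply/eqP; rewrite finset.eqEsubset Sw andbT.
  by apply/fintype.subsetP => i; apply: contraLR => iS; apply: Swc; rewrite mem_enum inE.
have -> : [set w | Q (Omega w)] = \bigcup_(S in [set` s]) cell S (enum (~: S)).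
  apply/seteqP; split=> w /=.
    move=> Qw; exists (Omega w); last by rewrite cellE.
    by rewrite /= mem_filter mem_enum asboolT.
  move=> [S /=]; rewrite mem_filter => /andP[/asboolP QS _].
  by rewrite cellE /= => ->.
rewrite measure_fin_bigcup//; last first.
  apply/trivIsetP => A B _ _ AB; rewrite !cellE; apply/seteqP; split=> // w [/= ->].
  by move/eqP; rewrite (negbTE AB).
rewrite -fsbig_seq; last by apply: filter_uniq; exact: enum_uniq.
rewrite big_filter big_enum_cond/=.
under eq_bigr => S _.
  rewrite prob_cell ?enum_uniq//; last by move=> i; rewrite mem_enum inE.
  rewrite -bweightE; over.
rewrite sumEFin; congr EFin; rewrite big_mkcond; apply: eq_bigr => S _.
by case: ifP => _ /=; rewrite ?mulr1 ?mulr0.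
Qed.

End LawOfRandomSet.

(** * Exponential moments of one guarded batch *)

(** From [exp (- u) >= 1 - u] one gets [exp u <= 1 / (1 - u)], and multiplying the claimed bound by
    [1 - u] leaves the surplus [u^2 (1 - 2 u)]. *)
Lemma expR_le_quad (R : realType) (u : R) : u <= 1/2 ->
  expR u <= 1 + u + 2 * u ^+ 2.
Proof.
move=> u12; have u1 : 0 < 1 - u by lra.
have : expR u <= (1 - u)^-1.
  rewrite -[u in X in X <= _]opprK expRN lef_pV2 ?posrE ?expR_gt0//.
  exact: expR_ge1Dx.
move=> /le_trans; apply; rewrite -(ler_pM2l u1) mulfV ?gt_eqF//.
rewrite -subr_ge0 (_ : _ - _ = u ^+ 2 * (1 - 2 * u)); last by ring.
by rewrite mulr_ge0 ?sqr_ge0//; lra.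
Qed.

Section GuardedStep.
Variables (R : realType) (I : finType).
Implicit Types (p kappa y : R) (z : I -> R) (good : pred {set I}).

(** A Bernstein-type bound: [expR_le_quad] is applied in each factor, [1 + x <= exp x] turns the
    product into the exponential of a sum, and the linear terms cancel. *)
Lemma bmean_expR_selsum_le p z : 0 <= p <= 1 -> p * \sum_i z i = 0 ->
  (forall i, z i <= 1/2) ->
  bmean p (fun S => expR (selsum z S)) <= expR (2 * (p * \sum_i z i ^+ 2)).
Proof.
move=> /andP[p0 p1] z0 z12; rewrite bmean_expR_selsum.
apply: (@le_trans _ _ (\prod_i expR (p * z i + 2 * (p * z i ^+ 2)))).
  apply: ler_prod => i _; apply/andP; split.
    have := expR_gt0 (z i) => e0.
    have : 0 <= p * expR (z i) by rewrite mulr_ge0// ltW.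
    lra.
  apply: le_trans (expR_ge1Dx _); rewrite lerD2l.
  have := expR_le_quad (z12 i).
  rewrite -lerBlDr => /(ler_wpM2l p0) h; nra.
by rewrite -expR_sum ler_expR big_split /= -!mulr_sumr z0 add0r.
Qed.

(* On a bad set the exponential is replaced by [1]; as [exp u >= 1 + u], the
   loss is at most [y |Z|] there, and [|Z| <= 1 + Z^2/4] turns it into the
   probability of being bad plus a variance.  The drift [3/64 y] beats both. *)
Lemma bmean_guarded_expR p kappa y z good :
  0 <= p <= 1 -> 0 <= kappa <= 1/400 -> 0 <= y <= 1 ->
  p * \sum_i z i = 0 -> p * \sum_i z i ^+ 2 <= kappa ->
  (forall i, z i <= kappa) ->
  bmean p (fun S => (~~ good S)%:R) <= 4 * kappa ->
  bmean p (fun S => if good S then expR (y * selsum z S - 3/64 * y) else 1) <= 1.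
Proof.
move=> p01 /andP[k0 k1] /andP[y0 y1] z0 zV zk pbad.
set e := expR (- (3/64 * y)).
have e0 : 0 < e by exact: expR_gt0.
have e1 : e * (1 + 3/64 * y) <= 1.
  rewrite /e expRN mulrC ler_pdivrMr ?expR_gt0// mul1r.
  exact: expR_ge1Dx.
have mexp : bmean p (fun S => expR (y * selsum z S)) <= 1 + 4 * y * kappa.
  apply: (@le_trans _ _ (expR (2 * (p * \sum_i (y * z i) ^+ 2)))).
    rewrite (eq_bmean _ (G := fun S => expR (selsum (fun i => y * z i) S))).
      apply: bmean_expR_selsum_le => //; first by rewrite -mulr_sumr mulrCA z0 mulr0.
      move=> i; have := zk i; nra.
    by move=> S; rewrite /selsum mulr_sumr.
  under eq_bigr do rewrite exprMn; rewrite -mulr_sumr [p * _]mulrCA.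
  set V := p * _ in zV *.
  have V0 : 0 <= V.
    by case/andP: p01 => ? _; rewrite mulr_ge0 ?sumr_ge0// => i _; rewrite sqr_ge0.
  have yy : y ^+ 2 * V <= y * kappa.
    by rewrite expr2 -mulrA; apply: ler_wpM2l => //; apply: le_trans zV; apply: ler_piMl.
  have yk : y * kappa <= 1/400 by nra.
  have yV : 0 <= y ^+ 2 * V by rewrite mulr_ge0// sqr_ge0.
  apply: le_trans (expR_le_quad _) _; first lra.
  move: yV yy; set U := y ^+ 2 * V => U0 Uk.
  have : U * U <= U * (1/400) by rewrite ler_wpM2l//; exact: le_trans yk.
  rewrite exprMn [U ^+ 2]expr2; lra.
have msqr : bmean p (fun S => selsum z S ^+ 2) <= kappa.
  have := bmean_selsum_var z0.
  rewrite (eq_bmean _ (G := fun S => selsum z S ^+ 2)); last first.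
    by move=> S; rewrite subr0.
  by move=> /le_trans; apply.
(* A pointwise majorant. On a bad set, writing [Z] for the sum, [exp (y Z) >= 1 + y Z] bounds it
   below by [1 + e y (1 + Z / 2)^2]. *)
apply: (@le_trans _ _ (bmean p (fun S => e * expR (y * selsum z S) +
   ((1 - e + e * y) * (~~ good S)%:R + e * y / 4 * selsum z S ^+ 2)))).
  apply: le_bmean => // S; rewrite expRD -/e.
  have ey : 0 <= e * y by rewrite mulr_ge0// ltW.
  have sq := sqr_ge0 (selsum z S).
  case: (good S) => /=.
    rewrite mulr0 add0r mulrC lerDl; apply: mulr_ge0 => //.
    by rewrite divr_ge0.
  have := expR_ge1Dx (y * selsum z S); move: sq.
  set Z := selsum z S; set E := expR _ => sq E1.
  have : e * (1 + y * Z) <= e * E by rewrite ler_wpM2l// ltW.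
  have : 0 <= e * y * (Z / 2 + 1) ^+ 2 by rewrite mulr_ge0// sqr_ge0.
  rewrite mulr1; lra.
rewrite !bmeanD !bmeanZ.
set mb := bmean p _ in pbad *; set me := bmean p _ in mexp *.
set ms := bmean p _ in msqr *.
have t1 : e * me <= e * (1 + 4 * y * kappa) by rewrite ler_wpM2l// ltW.
have ele1 : e <= 1 by nra.
have t2 : (1 - e + e * y) * mb <= (1 - e + e * y) * (4 * kappa).
  by rewrite ler_wpM2l// addr_ge0 ?subr_ge0// mulr_ge0// ltW.
have t3 : e * y / 4 * ms <= e * y / 4 * kappa.
  by rewrite ler_wpM2l// divr_ge0// mulr_ge0// ltW.
have ey : 0 <= e * y by rewrite mulr_ge0// ltW.
have eyk : e * y * kappa <= e * y * (1/400) by rewrite ler_wpM2l.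
have ek : (1 - e) * kappa <= (1 - e) * (1/400) by rewrite ler_wpM2l// subr_ge0.
(* The errors total [33/4 e y kappa + 4 (1 - e) kappa <= 33/1600 e y + (1 - e) / 100], while [e1]
   gives [1 - e >= 3/64 e y]. *)
lra.
Qed.

Lemma bmean_guarded p (a b c : R) good : 0 <= p <= 1 -> 0 <= b ->
  a <= c -> bmean p (fun S => (~~ good S)%:R) <= 1/4 -> c <= 1/2 * b ->
  bmean p (fun S => if good S then a else b) <= 3/4 * b.
Proof.
move=> p01 b0 ac pbad cb.
apply: (@le_trans _ _ (bmean p (fun S => 1/2 * b + b * (~~ good S)%:R))).
  by apply: le_bmean => // S; case: (good S) => /=; lra.
rewrite bmeanD bmeanZ bmean_cst.
have : b * bmean p (fun S => (~~ good S)%:R) <= b * (1/4) by rewrite ler_wpM2l.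
lra.
Qed.

End GuardedStep.

(** * Tight frames and golfing *)

Section DotProduct.
Variables (R : realType) (J : finType).
Implicit Types a b : J -> R.

Definition dotp a b : R := \sum_j a j * b j.

(** Cauchy-Schwarz, from Lagrange's identity, on the support of [b]: only the entries of [a] in [D]
    count, which produces the factor [#|D|] in the frame bounds. *)
Lemma dotp_sqr_le a b (D : {set J}) : (forall j, j \notin D -> b j = 0) ->
  dotp a b ^+ 2 <= (\sum_(j in D) a j ^+ 2) * dotp b b.
Proof.
move=> bD.
have -> : dotp a b = \sum_(j in D) a j * b j.
  rewrite [RHS]big_mkcond; apply: eq_bigr => j _.
  by case: ifPn => // /bD ->; rewrite mulr0.
have -> : dotp b b = \sum_(j in D) b j ^+ 2.
  rewrite [RHS]big_mkcond; apply: eq_bigr => j _; rewrite -expr2.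
  by case: ifPn => // /bD ->; rewrite expr0n.
have lagrange : \sum_(i in D) \sum_(j in D) (a i * b j - a j * b i) ^+ 2 =
    (\sum_(i in D) a i ^+ 2) * (\sum_(j in D) b j ^+ 2) +
    (\sum_(i in D) b i ^+ 2) * (\sum_(j in D) a j ^+ 2) -
    (\sum_(i in D) 2 * (a i * b i)) * (\sum_(j in D) a j * b j).
  rewrite !mulr_suml -big_split -sumrB /=.
  apply: eq_bigr => i _; rewrite !mulr_sumr -big_split -sumrB /=.
  by apply: eq_bigr => j _; ring.
have : 0 <= \sum_(i in D) \sum_(j in D) (a i * b j - a j * b i) ^+ 2.
  by apply: sumr_ge0 => i _; apply: sumr_ge0 => j _; rewrite sqr_ge0.
rewrite lagrange -mulr_sumr; lra.
Qed.

End DotProduct.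

Section TightFrame.
Variables (R : realType) (I J : finType) (u w : I -> J -> R).
Implicit Types (q v a h : J -> R) (S A B : {set I}) (k : I) (j : J) (D : {set J}).

(** [u k] and [w k] model the real and imaginary parts of one complex exponential. The first
    condition is a resolution of the identity with constant [#|I|], the second says that all entries
    have modulus one. *)
Definition tight_frame :=
  (forall j j', \sum_k (u k j * u k j' + w k j * w k j') =
                #|I|%:R * (j == j')%:R) /\
  (forall k j, u k j ^+ 2 + w k j ^+ 2 = 1).

Definition frame_part q j k : R := dotp (u k) q * u k j + dotp (w k) q * w k j.

(** In finite dimension this means that [v] lies in the span of the [u k] and [w k] with [k] in [S];
    the dual form is the one that recovery uses. *)
Definition observable S v := forall h,
  (forall k, k \in S -> dotp (u k) h = 0 /\ dotp (w k) h = 0) -> dotp v h = 0.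

Definition frame_avg (c : R) q A j : R := selsum (fun k => c * frame_part q j k) A.

Lemma dotp_frame_part q h k : dotp (frame_part q ^~ k) h =
  dotp (u k) q * dotp (u k) h + dotp (w k) q * dotp (w k) h.
Proof.
rewrite {1}/dotp; under eq_bigr do rewrite mulrDl -!mulrA.
by rewrite big_split /= -!mulr_sumr.
Qed.

Lemma observable_avg c q v A B (eta : R) : observable B v ->
  observable (A :|: B) (fun j => v j + eta * frame_avg c q A j).
Proof.
move=> Bv h hAB.
have -> : dotp (fun j => v j + eta * frame_avg c q A j) h =
    dotp v h + \sum_(k in A) eta * c * (dotp (u k) q * dotp (u k) h +
                                        dotp (w k) q * dotp (w k) h).
  under [X in _ = _ + X]eq_bigr do rewrite -dotp_frame_part mulr_sumr.
  rewrite exchange_big -big_split /=; apply: eq_bigr => j _.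
  rewrite mulrDl /frame_avg /selsum mulr_sumr mulr_suml; congr +%R.
  by apply: eq_bigr => k _; ring.
rewrite Bv => [|k kB]; last by apply: hAB; rewrite inE kB orbT.
rewrite big1 ?addr0// => k kA.
by have [|-> ->] := hAB k; rewrite ?inE ?kA//; ring.
Qed.

Hypothesis uwP : tight_frame.

Lemma sum_frame_part q j : \sum_k frame_part q j k = #|I|%:R * q j.
Proof.
rewrite /frame_part /dotp.
under eq_bigr do rewrite !mulr_suml -big_split /=.
rewrite exchange_big /= (bigD1 j)//= [X in _ + X]big1 => [|i ij].
  transitivity ((\sum_k (u k j * u k j + w k j * w k j)) * q j).
    by rewrite addr0 mulr_suml; apply: eq_bigr => k _; ring.
  by rewrite uwP.1 eqxx mulr1.
transitivity ((\sum_k (u k j * u k i + w k j * w k i)) * q i).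
  by rewrite mulr_suml; apply: eq_bigr => k _; ring.
by rewrite uwP.1 eq_sym (negbTE ij) mulr0 mul0r.
Qed.

(** [frame_part q j k] is the scalar product of the pair of coefficients of [q] with the unit vector
    [(u k j, w k j)] of the plane. *)
Lemma frame_part_sqr_le q j k :
  frame_part q j k ^+ 2 <= dotp (u k) q ^+ 2 + dotp (w k) q ^+ 2.
Proof.
rewrite -[leRHS]mulr1 -(uwP.2 k j) /frame_part -subr_ge0.
set a := dotp _ q; set b := dotp _ q.
rewrite (_ : _ - _ = (a * w k j - b * u k j) ^+ 2); last by ring.
exact: sqr_ge0.
Qed.

(** Parseval's identity: the energies of the coefficients add up to [#|I|%:R * dotp q q]. This
    controls the variance of a batch entry. *)
Lemma sum_frame_part_sqr q j :
  \sum_k frame_part q j k ^+ 2 <= #|I|%:R * dotp q q.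
Proof.
apply: (@le_trans _ _ (\sum_k (dotp (u k) q ^+ 2 + dotp (w k) q ^+ 2))).
  by apply: ler_sum => k _; exact: frame_part_sqr_le.
have -> : #|I|%:R * dotp q q = \sum_i q i * \sum_k frame_part q i k.
  by rewrite mulr_sumr; apply: eq_bigr => i _; rewrite sum_frame_part; ring.
under [leRHS]eq_bigr do rewrite mulr_sumr.
rewrite exchange_big; apply: ler_sum => k _ /=; rewrite !expr2.
have <- := dotp_frame_part q q k; rewrite /dotp.
by under [leRHS]eq_bigr do rewrite mulrC.
Qed.

Lemma frame_part_sqr_supp q j k D : (forall j, j \notin D -> q j = 0) ->
  frame_part q j k ^+ 2 <= #|D|%:R * dotp q q.
Proof.
move=> qD; apply: le_trans (frame_part_sqr_le _ _ _) _.
apply: le_trans (lerD (dotp_sqr_le _ qD) (dotp_sqr_le _ qD)) _.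
rewrite -mulrDl -big_split /= (eq_bigr (fun=> 1)) => [|i _]; last exact: uwP.2.
by rewrite sumr_const.
Qed.

End TightFrame.

Lemma ler_nasbool (R : numDomainType) (P Q : Prop) :
  (P -> Q) -> (~~ `[< Q >])%:R <= (~~ `[< P >])%:R :> R.
Proof.
move=> PQ; have [p|np] := pselect P; first by rewrite !asboolT//; exact: PQ.
by rewrite [in X in _ <= X]asboolF// lern1 leq_b1.
Qed.

Section Golfing.
Variables (R : realType) (I J : finType) (u w : I -> J -> R) (D : {set J}).
Variables (p lam G eps : R).
Hypothesis uwP : tight_frame u w.
Hypothesis p01 : 0 < p <= 1.
Hypothesis lam0 : 0 < lam.
Hypothesis D0 : (0 < #|D|)%N.
Hypothesis pI : 400 * #|D|%:R <= p * #|I|%:R.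
Hypothesis G0 : 0 < G.
Hypothesis eps0 : 0 < eps.
Hypothesis DG : #|D|%:R <= G * eps ^+ 2.
Implicit Types (q v : J -> R) (r : R) (A S : {set I}).

(* [v] is the part of the certificate already built, and [q] what is still to be
   matched on [D]. *)
Definition certifies q v S := exists a, [/\ observable u w S a,
  forall j, j \in D -> `|a j - q j| <= eps
  & forall j, j \notin D -> `|v j + a j| <= 1/4].

(** In the exponent a batch acts through [cap r] times a sum normalized by [r]; the cap at 1 keeps
    it in the range of [bmean_guarded_expR]. *)
Definition cap r : R := Num.min (lam * r) 1.

Definition shrink r : R := r - 3/8 * (cap r / lam).

Definition step_size r : R := cap r / (lam * r).

Definition batch q A : J -> R := frame_avg u w (p * #|I|%:R)^-1 q A.

Definition good_batch q r A : bool :=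
  \sum_(j in D) (batch q A j - q j) ^+ 2 <= r ^+ 2 * #|D|%:R / 4.

Definition residual q r A j : R :=
  if j \in D then q j - step_size r * batch q A j else 0.

(* While [r] is too large to stop, [G * growth r >= 1]; and [excess v r j >= 1]
   as soon as [v j] exceeds [1/4]. *)
Definition growth r : R := expR (3 * lam * r) * r ^+ 2.

Definition excess (v : J -> R) r j : R := expR (lam * (v j + r / 8 - 1/4)).

(** The potential of the recursion, a bound on the probability of failure with [n] batches left: one
    Markov term for the final residual, and one for each sign of each entry off [D]. *)
Definition golf_bound n v r : R := (3/4) ^+ n * (G * growth r) +
  \sum_(j in ~: D) (excess v r j + excess (\- v) r j).

Lemma shrink_gt0 r : 0 < r -> 0 < shrink r.
Proof.
move=> r0; have : cap r / lam <= r.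
  by rewrite ler_pdivrMr// mulrC; rewrite /cap ge_min lexx.
rewrite /shrink; lra.
Qed.

Lemma cap_bounds r : 0 < r -> 0 < cap r <= 1.
Proof. by move=> r0; rewrite /cap lt_min mulr_gt0// ltr01 ge_min lexx orbT. Qed.

Lemma step_size_bounds r : 0 < r -> 0 <= step_size r <= 1.
Proof.
move=> r0; have lr0 : 0 < lam * r by rewrite mulr_gt0.
have /andP[c0 c1] := cap_bounds r0.
apply/andP; split; first by rewrite divr_ge0// ltW.
by rewrite ler_pdivrMr// mul1r /cap ge_min lexx.
Qed.

Lemma growth_ge0 r : 0 <= growth r.
Proof. by rewrite mulr_ge0 ?expR_ge0// sqr_ge0. Qed.

(** Two regimes. If [lam * r <= 1], then [r] becomes [5/8 * r] and [25/64 <= 1/2]. Otherwise the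
    exponent [3 * lam * r] loses [9/8], and [exp (- 9/8) <= 1/2]. *)
Lemma growth_shrink r : 0 < r -> growth (shrink r) <= 1/2 * growth r.
Proof.
move=> r0; have s0 := shrink_gt0 r0; rewrite /growth.
have c0 : 0 <= cap r / lam.
  by rewrite divr_ge0// ltW//; have /andP[] := cap_bounds r0.
have sr : shrink r <= r by rewrite /shrink; lra.
have sqr : shrink r ^+ 2 <= r ^+ 2 by rewrite ler_sqr// nnegrE ltW.
have lexp : expR (3 * lam * shrink r) <= expR (3 * lam * r).
  by rewrite ler_expR ler_wpM2l// mulr_ge0// ltW.
have e0 := expR_gt0 (3 * lam * shrink r).
have [lr|lr] := leP (lam * r) 1.
  have sE : shrink r = 5/8 * r.
    by rewrite /shrink /cap min_l//; field; rewrite gt_eqF.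
  have : shrink r ^+ 2 <= 1/2 * r ^+ 2.
    by rewrite sE; have := sqr_ge0 r; lra.
  move=> /(ler_wpM2l (ltW e0)) /le_trans; apply.
  rewrite mulrCA ler_pM2l; last by lra.
  by rewrite ler_wpM2r// sqr_ge0.
have sE : 3 * lam * shrink r = 3 * lam * r - 9/8.
  by rewrite /shrink /cap min_r ?ltW//; field; rewrite gt_eqF.
have e98 : expR (- (9/8)) <= 1/2 :> R.
  rewrite expRN div1r lef_pV2 ?posrE ?expR_gt0//.
  by apply: le_trans (expR_ge1Dx _); lra.
rewrite sE expRD -mulrA mulrCA; apply: ler_pM; rewrite ?expR_ge0//.
- by rewrite mulr_ge0 ?expR_ge0// sqr_ge0.
- by rewrite ler_wpM2l// expR_ge0.
Qed.

Let kappa : R := #|D|%:R / (p * #|I|%:R).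

Let s0 : 0 < #|D|%:R :> R. Proof. by rewrite ltr0n. Qed.

Let pI0 : 0 < p * #|I|%:R.
Proof. by apply: lt_le_trans pI; rewrite mulr_gt0 ?ltr0n. Qed.

Let p0 : 0 < p. Proof. by case/andP: p01. Qed.

Let p01' : 0 <= p <= 1. Proof. by case/andP: p01 => /ltW -> ->. Qed.

Let kappa_bounds : 0 <= kappa <= 1/400.
Proof.
apply/andP; split; first by rewrite divr_ge0// ltW.
by rewrite ler_pdivrMr//; move: pI; lra.
Qed.

Lemma batch_mean q j :
  p * \sum_k ((p * #|I|%:R)^-1 * frame_part u w q j k) = q j.
Proof.
by rewrite -mulr_sumr (sum_frame_part uwP) mulrCA [X in _ * X]mulrA mulKf ?gt_eqF.
Qed.

Lemma batch_sqr q j :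
  p * \sum_k ((p * #|I|%:R)^-1 * frame_part u w q j k) ^+ 2 <=
  (p * #|I|%:R)^-1 * dotp q q.
Proof.
under eq_bigr do rewrite exprMn; rewrite -mulr_sumr.
have := sum_frame_part_sqr uwP q j.
have I0 : 0 < #|I|%:R :> R by have := pI0; rewrite pmulr_rgt0.
have c0 : 0 <= p * (p * #|I|%:R)^-1 ^+ 2.
  by rewrite mulr_ge0 ?sqr_ge0// ltW.
move=> /(ler_wpM2l c0); rewrite -mulrA => /le_trans; apply.
rewrite le_eqVlt; apply/orP; left; apply/eqP.
by move: I0; set n := #|I|%:R => n0; field; rewrite !gt_eqF.
Qed.

(** Markov's inequality: the squared error on [D] has mean at most [kappa * r^2 * #|D|], and a bad
    batch exceeds a quarter of [r^2 * #|D|]. *)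
Lemma prob_bad_batch q r : 0 < r -> dotp q q <= r ^+ 2 * #|D|%:R ->
  bmean p (fun A => (~~ good_batch q r A)%:R) <= 4 * kappa.
Proof.
move=> r0 qr; have c0 : 0 < r ^+ 2 * #|D|%:R / 4 by rewrite divr_gt0// mulr_gt0// exprn_gt0.
rewrite -(ler_pM2l c0) -bmeanZ.
apply: (@le_trans _ _ (bmean p (fun A => \sum_(j in D) (batch q A j - q j) ^+ 2))).
  apply: le_bmean => // A; case: (boolP (good_batch q r A)) => [_|] /=.
    by rewrite mulr0; apply: sumr_ge0 => j _; rewrite sqr_ge0.
  by rewrite -ltNge mulr1 => /ltW.
rewrite (bmean_sum _ (fun j => j \in D)).
apply: (@le_trans _ _ (\sum_(j in D) (p * #|I|%:R)^-1 * dotp q q)).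
  apply: ler_sum => j _; apply: le_trans (batch_sqr q j).
  exact: bmean_selsum_var (batch_mean q j).
rewrite sumr_const -[X in X <= _]mulr_natl mulrA -/kappa.
have /andP[k0 _] := kappa_bounds.
move: (ler_wpM2l k0 qr); lra.
Qed.

(** With [h] the step size, the residual on [D] is [(1 - h) q + h (q - batch)]. Convexity of the
    square gives the factor [1 - 3/4 h <= (1 - 3/8 h)^2], hence the [3/8] in [shrink]. *)
Lemma residual_sqr q r A : 0 < r -> (forall j, j \notin D -> q j = 0) ->
  dotp q q <= r ^+ 2 * #|D|%:R -> good_batch q r A ->
  dotp (residual q r A) (residual q r A) <= shrink r ^+ 2 * #|D|%:R.
Proof.
move=> r0 qD qr gA; have /andP[h0 h1] := step_size_bounds r0.
have -> : dotp (residual q r A) (residual q r A) =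
    \sum_(j in D) (q j - step_size r * batch q A j) ^+ 2.
  rewrite [RHS]big_mkcond; apply: eq_bigr => j _; rewrite /residual.
  by case: ifP => _; rewrite ?mulr0// -expr2.
have qqE : dotp q q = \sum_(j in D) q j ^+ 2.
  rewrite [RHS]big_mkcond; apply: eq_bigr => j _; rewrite -expr2.
  by case: ifPn => // /qD ->; rewrite expr0n.
have : \sum_(j in D) (q j - step_size r * batch q A j) ^+ 2 <=
    (1 - step_size r) * dotp q q + step_size r * \sum_(j in D) (batch q A j - q j) ^+ 2.
  rewrite qqE !mulr_sumr -big_split; apply: ler_sum => j _ /=.
  rewrite -subr_ge0.
  rewrite (_ : _ - _ = step_size r * (1 - step_size r) * batch q A j ^+ 2); last by ring.
  by rewrite mulr_ge0 ?sqr_ge0// mulr_ge0// subr_ge0.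
move=> /le_trans; apply.
have -> : shrink r = r * (1 - 3/8 * step_size r).
  by rewrite /shrink /step_size; field; rewrite !gt_eqF.
have h1' : 0 <= 1 - step_size r by rewrite subr_ge0.
have t1 := ler_wpM2l h1' qr; have t2 := ler_wpM2l h0 gA.
have : 0 <= r ^+ 2 * #|D|%:R * (3/8 * step_size r) ^+ 2.
  by rewrite mulr_ge0 ?sqr_ge0// mulr_ge0 ?sqr_ge0// ltW.
have -> : (r * (1 - 3/8 * step_size r)) ^+ 2 * #|D|%:R =
    r ^+ 2 * #|D|%:R * (1 - 3/8 * step_size r) ^+ 2 by ring.
move: t1 t2; set X := r ^+ 2 * _; set S := \sum_(j in D) _.
set Q := dotp q q; set h := step_size r => t1 t2 t3; lra.
Qed.

(** The supermartingale step; [sigma] stands for either sign. Off [D] the target is 0, so the batch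
    entry is centered, and the size of [q] makes both the variance and the terms of the normalized
    sum at most [kappa]. *)
Lemma bmean_excess q (v : R) r j (sigma : R) : sigma ^+ 2 = 1 -> 0 < r ->
  (forall j, j \notin D -> q j = 0) ->
  dotp q q <= r ^+ 2 * #|D|%:R -> j \notin D ->
  bmean p (fun A => if good_batch q r A
    then expR (lam * (sigma * (v + step_size r * batch q A j) + shrink r / 8 - 1/4))
    else expR (lam * (sigma * v + r / 8 - 1/4))) <=
  expR (lam * (sigma * v + r / 8 - 1/4)).
Proof.
move=> sg r0 qD qr jD; set E := expR _.
have E0 : 0 < E by exact: expR_gt0.
pose z k := sigma * r^-1 * ((p * #|I|%:R)^-1 * frame_part u w q j k).
have /andP[c0 c1] := cap_bounds r0.
(* The loss [3/64 * cap r] is [lam / 8] times the decrease [3/8 * (cap r / lam)] of [r]. *)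
rewrite (eq_bmean _ (G := fun A => E * (if good_batch q r A
    then expR (cap r * selsum z A - 3/64 * cap r) else 1))); last first.
  move=> A; case: ifP; rewrite ?mulr1// => _; rewrite -expRD; congr expR.
  have -> : selsum z A = sigma * r^-1 * batch q A j.
    by rewrite /selsum -mulr_sumr.
  by rewrite /shrink /step_size; field; rewrite !gt_eqF.
rewrite bmeanZ ger_pMr//.
have zsum : p * \sum_k z k = 0.
  by rewrite -mulr_sumr mulrCA batch_mean qD// mulr0.
have sr2 : (sigma * r^-1) ^+ 2 = (r ^+ 2)^-1 by rewrite exprMn sg mul1r exprVn.
have r2 : 0 < r ^+ 2 by rewrite exprn_gt0.
have zsqr : p * \sum_k z k ^+ 2 <= kappa.
  under eq_bigr do rewrite exprMn sr2.
  rewrite -mulr_sumr mulrCA mulrC ler_pdivrMr//.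
  apply: le_trans (batch_sqr q j) _.
  by rewrite mulrC ler_pdivrMr//= /kappa mulrAC divfK ?gt_eqF// mulrC.
apply: (@bmean_guarded_expR _ _ _ kappa) => //; first by rewrite ltW.
  move=> k; have /andP[k0 _] := kappa_bounds.
  have : `|z k| <= `|kappa|.
    rewrite -ler_sqr ?nnegrE// !real_normK ?num_real//.
    have -> : z k ^+ 2 = (p * #|I|%:R)^-1 ^+ 2 *
        ((r ^+ 2)^-1 * frame_part u w q j k ^+ 2).
      by rewrite /z exprMn sr2 exprMn mulrCA.
    rewrite /kappa exprMn [X in _ <= X]mulrC ler_wpM2l ?sqr_ge0//.
    rewrite ler_pdivrMl//; apply: le_trans (frame_part_sqr_supp uwP j k qD) _.
    apply: le_trans (ler_wpM2l (ltW s0) qr) _.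
    by rewrite mulrCA -expr2.
  by rewrite (ger0_norm k0); apply: le_trans; rewrite ler_norm.
exact: prob_bad_batch.
Qed.

Lemma certifies_step q v r A S : 0 < r ->
  certifies (residual q r A) (fun j => v j + step_size r * batch q A j) S ->
  certifies q v (A :|: S).
Proof.
move=> r0 [a [Sa aD aDC]].
exists (fun j => a j + step_size r * batch q A j); split.
- exact: observable_avg.
- move=> j jD; have := aD j jD; rewrite /residual jD.
  by rewrite opprB addrA addrAC.
- by move=> j /aDC; rewrite -addrA [step_size r * _ + _]addrC.
Qed.

Lemma certifies_setUr q v A S : certifies q v S -> certifies q v (A :|: S).
Proof.
move=> [a [Sa aD aDC]]; exists a; split=> // h hAS.
by apply: Sa => k kS; apply: hAS; rewrite inE kS orbT.
Qed.

Lemma golf_bound_ge0 n v r : 0 <= golf_bound n v r.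
Proof.
apply: addr_ge0.
  apply: mulr_ge0; first by apply: exprn_ge0; lra.
  by rewrite mulr_ge0 ?(ltW G0) ?growth_ge0.
by apply: sumr_ge0 => j _; rewrite addr_ge0 ?expR_ge0.
Qed.

(** With no batch left the candidate is the zero vector. If [G * r^2 <= 1], then [DG] bounds the
    entries of [q] by [eps]; otherwise the first term of the potential exceeds 1. An entry of [v]
    beyond [1/4] makes an [excess] at least 1. *)
Lemma golf_bound0 q v r : 0 < r -> (forall j, j \notin D -> q j = 0) ->
  dotp q q <= r ^+ 2 * #|D|%:R ->
  (forall S, certifies q v S) \/ 1 <= golf_bound 0 v r.
Proof.
move=> r0 qD qr; rewrite /golf_bound expr0 mul1r.
have sum0 (Q : pred J) : 0 <= \sum_(j | Q j) (excess v r j + excess (\- v) r j).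
  by apply: sumr_ge0 => j _; rewrite addr_ge0 ?expR_ge0.
have [Gr|Gr] := leP (G * r ^+ 2) 1; last first.
  right; apply: ler_wpDr => //; apply: (le_trans (ltW Gr)).
  rewrite ler_wpM2l ?(ltW G0)// /growth ler_peMl ?sqr_ge0//.
  by rewrite -expR0 ler_expR !mulr_ge0// ltW.
have [vD|] := pselect (forall j, j \notin D -> `|v j| <= 1/4).
  left=> S; exists (fun=> 0); split.
  - by move=> h _; rewrite /dotp big1// => j _; rewrite mul0r.
  - move=> j jD; rewrite sub0r normrN -ler_sqr ?nnegrE ?(ltW eps0)//.
    rewrite real_normK ?num_real//.
    apply: (@le_trans _ _ (dotp q q)).
      rewrite /dotp (bigD1 j)//= -expr2 lerDl.
      by apply: sumr_ge0 => i _; rewrite -expr2 sqr_ge0.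
    apply: (le_trans qr); apply: (@le_trans _ _ (r ^+ 2 * (G * eps ^+ 2))).
      by rewrite ler_wpM2l ?sqr_ge0.
    by rewrite mulrA [_ * G]mulrC ler_piMl ?sqr_ge0.
  - by move=> j /vD; rewrite addr0.
move=> /existsNP[j /not_implyP[jD /negP]]; rewrite -ltNge => vj.
right; apply: ler_wpDl; first by rewrite mulr_ge0 ?growth_ge0// ltW.
rewrite (bigD1 j) ?inE//=; apply: ler_wpDr => //.
have exp1 x : 1/4 < x -> 1 <= expR (lam * (x + r / 8 - 1/4)).
  by move=> x4; rewrite -[X in X <= _]expR0 ler_expR mulr_ge0 ?(ltW lam0)//; lra.
move: vj; rewrite ltr_normr => /orP[] /exp1 ?.
  by apply: ler_wpDr => //; rewrite expR_ge0.
by apply: ler_wpDl => //; rewrite expR_ge0.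
Qed.

Lemma bmean_golf_bound n q v r : 0 < r -> (forall j, j \notin D -> q j = 0) ->
  dotp q q <= r ^+ 2 * #|D|%:R ->
  bmean p (fun A => if good_batch q r A
    then golf_bound n (fun j => v j + step_size r * batch q A j) (shrink r)
    else golf_bound n v r) <= golf_bound n.+1 v r.
Proof.
move=> r0 qD qr.
pose vA A j := v j + step_size r * batch q A j.
rewrite (eq_bmean _ (G := fun A =>
  (3/4) ^+ n * G * (if good_batch q r A then growth (shrink r) else growth r) +
  \sum_(j in ~: D)
    ((if good_batch q r A then excess (vA A) (shrink r) j else excess v r j) +
     (if good_batch q r A then excess (\- vA A) (shrink r) j
      else excess (\- v) r j)))); last first.
  by move=> A; rewrite /golf_bound; case: ifP => _; rewrite mulrA.
rewrite bmeanD bmeanZ (bmean_sum _ (fun j => j \in ~: D)) /golf_bound.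
apply: lerD.
  rewrite exprSr -[X in X <= _]mulrA -[X in _ <= X]mulrA.
  apply: ler_wpM2l; first by apply: exprn_ge0; lra.
  rewrite [X in _ <= X]mulrCA ler_wpM2l ?(ltW G0)//.
  have gs := growth_shrink r0.
  apply: (bmean_guarded p01' (growth_ge0 r) gs _ (lexx _)).
  apply: le_trans (prob_bad_batch r0 qr) _.
  by have /andP[_] := kappa_bounds; lra.
apply: ler_sum => j; rewrite inE => jD; rewrite bmeanD; apply: lerD.
  have := bmean_excess (v j) (expr1n _ 2) r0 qD qr jD.
  rewrite (mul1r (v j)) => /(le_trans _); apply.
  rewrite le_eqVlt; apply/orP; left; apply/eqP; apply: eq_bmean => A.
  by rewrite /excess /vA [in RHS]mul1r.
have sg : (-1) ^+ 2 = 1 :> R by rewrite sqrrN expr1n.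
have := bmean_excess (v j) sg r0 qD qr jD.
rewrite (mulN1r (v j)) => /(le_trans _); apply.
rewrite le_eqVlt; apply/orP; left; apply/eqP; apply: eq_bmean => A.
by rewrite /excess /vA mulN1r.
Qed.

(** Induction on the number of batches: [bmean_setU] splits off one batch, a certificate for the
    updated state yields one for the current state, and [bmean_golf_bound] averages the potential.
    For [n = 0], a potential of at least 1 bounds any probability. *)
Lemma prob_not_certifies n q v r : 0 < r -> (forall j, j \notin D -> q j = 0) ->
  dotp q q <= r ^+ 2 * #|D|%:R ->
  bmean (1 - (1 - p) ^+ n) (fun S => (~~ `[< certifies q v S >])%:R) <=
  golf_bound n v r.
Proof.
have tau01 m : 0 <= 1 - (1 - p) ^+ m <= 1.
  case/andP: p01' => p_ge0 p_le1.
  rewrite subr_ge0 lerBlDr lerDl exprn_ge0 ?subr_ge0// andbT.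
  by rewrite exprn_ile1 ?subr_ge0// lerBlDr lerDl.
elim: n q v r => [|n IHn] q v r r0 qD qr.
  have [cert|ge1] := golf_bound0 v r0 qD qr.
    rewrite (eq_bmean _ (G := fun=> 0)) ?bmean_cst ?golf_bound_ge0// => S.
    by rewrite asboolT.
  apply: le_trans ge1; rewrite -[X in _ <= X](bmean_cst I (1 - (1 - p) ^+ 0)).
  by apply: le_bmean => // S; rewrite lern1 leq_b1.
have -> : 1 - (1 - p) ^+ n.+1 = 1 - (1 - p) * (1 - (1 - (1 - p) ^+ n)).
  by rewrite exprS; ring.
rewrite -bmean_setU; apply: le_trans (bmean_golf_bound n v r0 qD qr).
apply: le_bmean => // A; case: ifPn => gA.
  apply: le_trans (IHn (residual q r A) _ _ (shrink_gt0 r0) _ _).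
  - apply: le_bmean => // S; apply: ler_nasbool; exact: certifies_step.
  - by move=> j /negbTE jD; rewrite /residual jD.
  - exact: residual_sqr.
apply: le_trans (IHn _ _ _ r0 qD qr); apply: le_bmean => // S.
by apply: ler_nasbool; exact: certifies_setUr.
Qed.

End Golfing.

(** * The Fourier frame *)

Section TrigonometricSums.
Variable R : realType.
Implicit Types (x a : R) (m n : nat).

Lemma sin_shift2pi x m n : sin (2 * pi * m%:R - 2 * pi * n%:R + x) = sin x.
Proof.
rewrite -(periodicn (@sinD2pi R) n) (_ : _ + _ = x + (pi *+ 2) *+ m).
  exact: (periodicn (@sinD2pi R)).
by rewrite -[_ *+ n]mulr_natr -[_ *+ m]mulr_natr -[pi *+ 2]mulr_natr; ring.
Qed.

Lemma cos_shift2pi x m n : cos (2 * pi * m%:R - 2 * pi * n%:R + x) = cos x.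
Proof.
rewrite -(periodicn (@cosD2pi R) n) (_ : _ + _ = x + (pi *+ 2) *+ m).
  exact: (periodicn (@cosD2pi R)).
by rewrite -[_ *+ n]mulr_natr -[_ *+ m]mulr_natr -[pi *+ 2]mulr_natr; ring.
Qed.

(** The factor [2 * sin (a / 2)] makes the sum telescope. *)
Lemma sum_cos_arith a n : 2 * sin (a / 2) * \sum_(k < n) cos (k%:R * a) =
  sin (n%:R * a - a / 2) + sin (a / 2).
Proof.
elim: n => [|n IHn]; first by rewrite big_ord0 mul0r sub0r sinN; ring.
rewrite big_ord_recr /= mulrDr IHn.
rewrite (_ : n.+1%:R * a - a / 2 = n%:R * a + a / 2); last first.
  by rewrite -natr1; lra.
by rewrite sinB sinD; ring.
Qed.

Lemma sum_sin_arith a n : 2 * sin (a / 2) * \sum_(k < n) sin (k%:R * a) =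
  cos (a / 2) - cos (n%:R * a - a / 2).
Proof.
elim: n => [|n IHn]; first by rewrite big_ord0 mul0r sub0r cosN; ring.
rewrite big_ord_recr /= mulrDr IHn.
rewrite (_ : n.+1%:R * a - a / 2 = n%:R * a + a / 2); last first.
  by rewrite -natr1; lra.
by rewrite cosB cosD; ring.
Qed.

Lemma sin_neq0_pi x : 0 < `|x| < pi -> sin x != 0.
Proof.
move=> xpi; have : 0 < sin `|x| by exact: sin_gt0_pi.
by case: (ger0P x) => _; rewrite ?sinN ?oppr_gt0 => sx; rewrite ?(gt_eqF sx) ?(lt_eqF sx).
Qed.

End TrigonometricSums.

Section FourierFrame.
Variables (R : realType) (N : nat).
Implicit Types (k t : 'I_N) (j : 'I_N * bool) (h e f g : {ffun 'I_N -> R[i]}).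

Definition angle k t : R := 2 * pi * k%:R * t%:R / N%:R.

(* The coordinate [(t, false)] is the real part at [t] and [(t, true)] the
   imaginary part, so that [dft h k = dotp (fre k) h + i * dotp (fim k) h]. *)
Definition coords h j : R := if j.2 then complex.Im (h j.1) else complex.Re (h j.1).

Definition fre k j : R := if j.2 then sin (angle k j.1) else cos (angle k j.1).

Definition fim k j : R := if j.2 then cos (angle k j.1) else - sin (angle k j.1).

Lemma orthogonality (t t' : 'I_N) :
  \sum_k cos (angle k t - angle k t') = N%:R * (t == t')%:R /\
  \sum_k sin (angle k t - angle k t') = 0.
Proof.
have N0 : 0 < N%:R :> R by rewrite ltr0n; case: (N) t => // -[].
have [<-|tt'] := eqVneq t t'.
  under eq_bigr do rewrite subrr cos0.
  under [X in _ /\ X = _]eq_bigr do rewrite subrr sin0.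
  by rewrite sumr_const card_ord mulr1 big1.
set a : R := 2 * pi * (t%:R - t'%:R) / N%:R.
have angleB k : angle k t - angle k t' = k%:R * a by rewrite /angle /a; ring.
under eq_bigr do rewrite angleB.
under [X in _ /\ X = _]eq_bigr do rewrite angleB.
(* [N%:R * a] is a multiple of [2 * pi], so the boundary terms of the telescoped sums cancel;
   [sin (a / 2)] can be divided out because [0 < |a / 2| < pi]. *)
have Na : N%:R * a - a / 2 = 2 * pi * t%:R - 2 * pi * t'%:R + - (a / 2).
  by rewrite /a; field; rewrite gt_eqF.
have pi0 := @pi_gt0 R.
have s0 : sin (a / 2) != 0.
  apply: sin_neq0_pi.
  have -> : a / 2 = pi * ((t%:R - t'%:R) / N%:R) by rewrite /a; field; rewrite gt_eqF.
  rewrite normrM (gtr0_norm pi0) pmulr_rgt0// normr_gt0.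
  rewrite mulf_eq0 negb_or subr_eq0 eqr_nat tt' invr_eq0 (gt_eqF N0) /=.
  rewrite -[X in _ < X]mulr1 ltr_pM2l// normrM normfV (gtr0_norm N0).
  rewrite ltr_pdivrMr// mul1r ltr_norml.
  have tN : t%:R < N%:R :> R by rewrite ltr_nat.
  have tN' : t'%:R < N%:R :> R by rewrite ltr_nat.
  have : 0 <= t%:R :> R by []. have : 0 <= t'%:R :> R by [].
  by move=> ? ?; apply/andP; split; lra.
have s20 : 2 * sin (a / 2) != 0 by rewrite mulf_eq0 negb_or s0 pnatr_eq0.
split; apply: (mulfI s20).
  by rewrite sum_cos_arith Na sin_shift2pi sinN !mulr0 addNr.
by rewrite sum_sin_arith Na cos_shift2pi cosN subrr mulr0.
Qed.

Lemma fourier_tight : tight_frame fre fim.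
Proof.
split=> [[t b] [t' b']|k [t b]]; last first.
  by rewrite /fre /fim; case: b => /=; rewrite ?sqrrN ?cos2Dsin2// addrC cos2Dsin2.
have [cosE sinE] := orthogonality t t'; rewrite card_ord xpair_eqE /fre /fim /=.
case: b; case: b' => /=; rewrite ?andbT ?andbF ?mulr0 -?cosE.
- by apply: eq_bigr => k _; rewrite cosB; ring.
- by rewrite -[RHS]sinE; apply: eq_bigr => k _; rewrite sinB; ring.
- rewrite -[RHS]oppr0 -[X in _ = - X]sinE -sumrN; apply: eq_bigr => k _.
  by rewrite sinB; ring.
- by apply: eq_bigr => k _; rewrite cosB; ring.
Qed.

Lemma big_coords (F : 'I_N * bool -> R) (Q : pred 'I_N) :
  \sum_(j | Q j.1) F j = \sum_(t | Q t) (F (t, false) + F (t, true)).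
Proof.
transitivity (\sum_(t | Q t) \sum_b F (t, b)); last first.
  by apply: eq_bigr => t _; rewrite big_bool addrC.
rewrite pair_big /=; apply: eq_big => [j|[t b] _]; last by [].
by rewrite andbT.
Qed.

Lemma dft_coords h k :
  dft h k = Complex (dotp (fre k) (coords h)) (dotp (fim k) (coords h)).
Proof.
rewrite /dotp !(big_coords _ xpredT) /dft.
have -> : Complex (\sum_t (fre k (t, false) * coords h (t, false) +
      fre k (t, true) * coords h (t, true)))
    (\sum_t (fim k (t, false) * coords h (t, false) +
      fim k (t, true) * coords h (t, true))) =
    \sum_t Complex (fre k (t, false) * coords h (t, false) +
      fre k (t, true) * coords h (t, true))
    (fim k (t, false) * coords h (t, false) +
      fim k (t, true) * coords h (t, true)).
  apply: (@big_ind3 _ _ _ (fun (x y : R) (z : R[i]) => Complex x y = z)) => //.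
  by move=> x1 y1 z1 x2 y2 z2 <- <-.
apply: eq_bigr => t _; rewrite /fre /fim /coords /expi /angle /=.
rewrite cosN sinN; case: (h t) => a b /=.
apply/eqP; rewrite eq_complex /=; apply/andP; split; apply/eqP; ring.
Qed.

(** A cyclic shift multiplies the transform at [k] by a phase, so the shifted signal also vanishes
    there. *)
Lemma dft_diff e k : dft e k = 0 ->
  dft [ffun t => e t - e (ord_pred t)] k = 0.
Proof.
move=> ek.
have N0 : N%:R != 0 :> R by rewrite pnatr_eq0 -lt0n (leq_ltn_trans (leq0n k)).
have expiD (x y : R) : expi (x + y) = expi x * expi y.
  by rewrite /expi cosD sinD; apply/eqP; rewrite eq_complex /= !eqxx /= addrC.
rewrite /dft; under eq_bigr do rewrite ffunE mulrBl.
rewrite sumrB -/(dft e k) ek sub0r; apply/eqP; rewrite oppr_eq0; apply/eqP.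
rewrite (reindex_inj (@ordS_inj N)) /=.
rewrite (eq_bigr (fun t => e t * expi (- (2 * pi * k%:R * t%:R / N%:R)) *
    expi (- (2 * pi * k%:R / N%:R)))).
  by rewrite -mulr_suml -/(dft e k) ek mul0r.
move=> t _; rewrite ordSK -[RHS]mulrA -expiD; congr (_ * _).
have [tN|tN] := ltnP t.+1 N.
  by rewrite modn_small// -natr1; congr expi; field.
(* The wrap-around from [N - 1] to 0: the two phases differ by the full turns [2 * pi * k%:R]. *)
have -> : t.+1 = N by apply/eqP; rewrite eqn_leq tN ltn_ord.
rewrite modnn mulr0 mul0r oppr0.
have -> : - (2 * pi * k%:R * t%:R / N%:R) - 2 * pi * k%:R / N%:R =
    2 * pi * 0%N%:R - 2 * pi * k%:R + 0 :> R.
  have tE : t%:R = N%:R - 1 :> R.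
    apply/eqP; rewrite eq_sym subr_eq natr1 eqr_nat eqn_leq tN; exact: ltn_ord.
  by rewrite tE; field.
by rewrite /expi cos_shift2pi sin_shift2pi.
Qed.

End FourierFrame.

(** * Dual certificates and exact recovery *)

(** The certificate [a] is orthogonal to [h], so [q] can be replaced by [q - a], which is small on
    [D] and at most [1/4] off [D]. *)
Lemma certifies_pairing (R : realType) (I J : finType) (u w : I -> J -> R)
    (D : {set J}) (eps : R) (q h : J -> R) (S : {set I}) :
  (forall k, k \in S -> dotp (u k) h = 0 /\ dotp (w k) h = 0) ->
  (forall j, j \notin D -> q j = 0) ->
  certifies u w D eps q (fun=> 0) S ->
  `|dotp q h| <= eps * (\sum_(j in D) `|h j|) + 1/4 * \sum_(j | j \notin D) `|h j|.
Proof.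
move=> hS qD [a [/(_ h hS) ah aD aDC]].
have -> : dotp q h = - (\sum_(j in D) (a j - q j) * h j +
                        \sum_(j | j \notin D) a j * h j).
  rewrite -[LHS]subr0 -[X in _ - X]ah /dotp -sumrB (bigID (mem D)) /= opprD -!sumrN.
  congr +%R; apply: eq_bigr => j jD; first by ring.
  by rewrite qD//; ring.
rewrite normrN; apply: (le_trans (ler_normD _ _)); apply: lerD.
  apply: (le_trans (ler_norm_sum _ _ _)); rewrite mulr_sumr.
  by apply: ler_sum => j /aD; rewrite normrM => /ler_wpM2r; apply.
apply: (le_trans (ler_norm_sum _ _ _)); rewrite mulr_sumr.
by apply: ler_sum => j /aDC; rewrite add0r normrM => /ler_wpM2r; apply.
Qed.

Section ExactRecovery.
Variables (R : realType) (N : nat) (f : {ffun 'I_N -> R[i]}).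
Local Notation normc := ComplexField.Normc.normc.
Implicit Types (j : 'I_N * bool) (g h e : {ffun 'I_N -> R[i]}).

Definition diff g : {ffun 'I_N -> R[i]} := [ffun t => g t - g (ord_pred t)].

Definition jump_coords : {set 'I_N * bool} := [set j | j.1 \in jump_set f]%SET.

Definition jump_sign j : R :=
  coords (diff f) j / normc (diff f j.1).

Definition unit_vector j j' : R := (j' == j)%:R.

(** Summed over the at most [2 * N] jump coordinates this gives [1/4], which can be absorbed in
    [null_space_bounds]. *)
Definition tolerance : R := (8 * N%:R)^-1.

Definition certified S (q : 'I_N * bool -> R) :=
  certifies (@fre R N) (@fim R N) jump_coords tolerance q (fun=> 0) S.

Lemma card_jump_coords : #|jump_coords| = (2 * #|jump_set f|)%N.
Proof.
have -> : jump_coords = finset.setX (jump_set f) [set: bool]%SET.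
  by apply/setP => -[t b]; rewrite !inE andbT.
by rewrite cardsX cardsT card_bool mulnC.
Qed.

Lemma jump_sign_supp j : j \notin jump_coords -> jump_sign j = 0.
Proof.
rewrite !inE negbK => /eqP ft; rewrite /jump_sign /coords ffunE ft subrr.
by case: ifP; rewrite /= mul0r.
Qed.

Lemma complexReD (x y : R[i]) : complex.Re (x + y) = complex.Re x + complex.Re y.
Proof. by case: x y => ? ? []. Qed.

Lemma complexImD (x y : R[i]) : complex.Im (x + y) = complex.Im x + complex.Im y.
Proof. by case: x y => ? ? []. Qed.

Lemma normc_sqr (z : R[i]) : normc z ^+ 2 = complex.Re z ^+ 2 + complex.Im z ^+ 2.
Proof. by case: z => a b /=; rewrite sqr_sqrtr// addr_ge0 ?sqr_ge0. Qed.

Lemma normc_ge0 (z : R[i]) : 0 <= normc z.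
Proof. by case: z => a b /=; rewrite sqrtr_ge0. Qed.

Lemma jump_normc_gt0 t : t \in jump_set f -> 0 < normc (diff f t).
Proof.
rewrite inE => ft; rewrite lt_neqAle normc_ge0 andbT eq_sym.
apply: contra ft => /eqP /ComplexField.Normc.eq0_normc.
by rewrite ffunE => /eqP; rewrite subr_eq0.
Qed.

Lemma jump_sign_sqr t : t \in jump_set f ->
  jump_sign (t, false) ^+ 2 + jump_sign (t, true) ^+ 2 = 1.
Proof.
move=> /jump_normc_gt0 n0; rewrite /jump_sign /coords /= !exprMn -mulrDl.
by rewrite -normc_sqr -exprMn mulfV ?expr1n// gt_eqF.
Qed.

Lemma dotp_jump_sign : dotp jump_sign jump_sign <= #|jump_coords|%:R.
Proof.
rewrite /dotp (bigID (mem jump_coords)) /= [X in _ + X]big1 => [|j jD]; last first.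
  by rewrite jump_sign_supp// mul0r.
rewrite addr0 -sum1_card natr_sum; apply: ler_sum => -[t b]; rewrite inE => /= tT.
have := jump_sign_sqr tT; have := sqr_ge0 (jump_sign (t, true)).
by have := sqr_ge0 (jump_sign (t, false)); rewrite !expr2; case: b; lra.
Qed.

(** Convexity of the modulus: the unit vector [jump_sign] is its gradient at the jump. The right
    side dominates the scalar product of the shifted jump with that vector. *)
Lemma normc_shift_jump (h : R[i]) t : t \in jump_set f ->
  normc (diff f t) + jump_sign (t, false) * complex.Re h +
    jump_sign (t, true) * complex.Im h <= normc (diff f t + h).
Proof.
move=> tT; have n0 := jump_normc_gt0 tT; have := jump_sign_sqr tT.
have xE : complex.Re (diff f t) = normc (diff f t) * jump_sign (t, false).
  by rewrite /jump_sign /coords /= mulrC divfK// gt_eqF.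
have yE : complex.Im (diff f t) = normc (diff f t) * jump_sign (t, true).
  by rewrite /jump_sign /coords /= mulrC divfK// gt_eqF.
move: xE yE; set s1 := jump_sign _; set s2 := jump_sign _.
move: (normc_sqr (diff f t + h)) (normc_ge0 (diff f t + h)).
set n' := normc (_ + _); set n := normc _ in n0 *.
rewrite complexReD complexImD.
set x := complex.Re (diff f t); set y := complex.Im (diff f t).
set a := complex.Re h; set b := complex.Im h.
move=> n'E n'0 xE yE s12.
have -> : n + s1 * a + s2 * b = s1 * (x + a) + s2 * (y + b).
  by rewrite xE yE -[n in LHS]mulr1 -s12; ring.
apply: (le_trans (ler_norm _)); rewrite -ler_sqr ?nnegrE// real_normK ?num_real//.
rewrite n'E -[X in _ <= X]mul1r -s12 -subr_ge0.
rewrite (_ : _ - _ = (s1 * (y + b) - s2 * (x + a)) ^+ 2); last by ring.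
exact: sqr_ge0.
Qed.

Lemma coords_norm_le h t :
  `|coords h (t, false)| + `|coords h (t, true)| <= 2 * normc (h t).
Proof.
have n0 := normc_ge0 (h t); have := normc_sqr (h t); rewrite /coords /=.
set a := complex.Re _; set b := complex.Im _; set n := normc _ in n0 * => nE.
have le1 (x : R) : x ^+ 2 <= n ^+ 2 -> `|x| <= n.
  by move=> xn; rewrite -ler_sqr ?nnegrE// real_normK ?num_real.
rewrite mulr2n mulrDl mul1r; apply: lerD; apply: le1; rewrite nE.
  by rewrite lerDl sqr_ge0.
by rewrite lerDr sqr_ge0.
Qed.

Section Certificates.
Variable S : {set 'I_N}.
Hypothesis N0 : (0 < N)%N.
Hypothesis sign_certified : certified S jump_sign.
Hypothesis unit_certified :
  forall j, j \in jump_coords -> certified S (unit_vector j).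

(** With [A] the sum on the jump coordinates, the unit vectors give [A <= A / 4 + N B / 2]. The sign
    vector then costs [tolerance * A <= B / 8] on the jumps and [B / 4] off them, in total
    [3/8 * B]. *)
Lemma null_space_bounds (h : 'I_N * bool -> R) :
  (forall k, k \in S -> dotp (fre R k) h = 0 /\ dotp (fim R k) h = 0) ->
  let B := \sum_(j | j \notin jump_coords) `|h j| in
  \sum_(j in jump_coords) `|h j| <= N%:R * B /\ - (3/8) * B <= dotp jump_sign h.
Proof.
move=> hS B; set A := \sum_(j in _) _.
have n0 : 0 < N%:R :> R by rewrite ltr0n.
have B0 : 0 <= B by apply: sumr_ge0.
have A0 : 0 <= A by apply: sumr_ge0.
have tol0 : 0 <= tolerance by rewrite invr_ge0 mulr_ge0.
have hj j : j \in jump_coords -> `|h j| <= tolerance * A + 1/4 * B.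
  move=> jD; have := unit_certified jD => /(certifies_pairing hS).
  have -> : dotp (unit_vector j) h = h j.
    rewrite /dotp (bigD1 j)//= /unit_vector eqxx mul1r big1 ?addr0// => i.
    by move=> /negbTE ->; rewrite mul0r.
  apply => i; apply: contraNeq; rewrite /unit_vector pnatr_eq0 eqb0 negbK.
  by move=> /eqP ->.
have cardD : #|jump_coords|%:R <= 2 * N%:R :> R.
  rewrite -natrM ler_nat card_jump_coords leq_mul2l /=.
  by rewrite (leq_trans (max_card _))// card_ord.
have AB : A <= N%:R * B.
  have : A <= \sum_(j in jump_coords) (tolerance * A + 1/4 * B).
    by apply: ler_sum => j; exact: hj.
  rewrite sumr_const -[X in _ <= X]mulr_natl => A1.
  have tB0 : 0 <= tolerance * A + 1/4 * B.
    by apply: addr_ge0; apply: mulr_ge0 => //; rewrite divr_ge0.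
  have := ler_wpM2r tB0 cardD; move=> /(le_trans A1).
  have -> : 2 * N%:R * (tolerance * A + 1/4 * B) = 1/4 * A + 1/2 * (N%:R * B).
    by rewrite /tolerance; field; rewrite gt_eqF.
  have : 0 <= N%:R * B by rewrite mulr_ge0// ltW.
  lra.
split => //.
have := certifies_pairing hS jump_sign_supp sign_certified.
rewrite -/A -/B => /ler_normlP[+ _].
have : tolerance * A <= 1/8 * B.
  have -> : 1/8 * B = tolerance * (N%:R * B).
    by rewrite /tolerance; field; rewrite gt_eqF.
  by rewrite ler_wpM2l.
lra.
Qed.

Lemma feasible_total_variation g : feasible f S g ->
  total_variation g <= total_variation f -> g = f.
Proof.
move=> gS gf; pose e := [ffun t => g t - f t]; pose h := diff e.
have dfte k : k \in S \/ k = 0%N :> nat -> dft e k = 0.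
  move=> /gS; rewrite /dft => gfk; under eq_bigr do rewrite ffunE mulrBl.
  by rewrite sumrB gfk subrr.
have hS k : k \in S -> dotp (fre R k) (coords h) = 0 /\ dotp (fim R k) (coords h) = 0.
  move=> kS; have := dft_diff (dfte k (or_introl kS)); rewrite -/(diff e) -/h.
  by rewrite dft_coords => /eqP; rewrite eq_complex => /andP[/eqP ? /eqP ?].
have [AB Bsign] := null_space_bounds hS.
have gE t : g t - g (ord_pred t) = diff f t + h t.
  by rewrite !ffunE; ring.
move: gf; rewrite /total_variation; under eq_bigr do rewrite gE.
under [X in _ <= X -> _]eq_bigr => t _.
  rewrite (_ : f t - f (ord_pred t) = diff f t); last by rewrite ffunE.
  over.
rewrite (bigID (mem (jump_set f))) [X in _ <= X -> _](bigID (mem (jump_set f))) /=.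
have fT t : t \notin jump_set f -> diff f t = 0.
  by rewrite inE negbK => /eqP ft; rewrite ffunE ft subrr.
rewrite [X in _ <= _ + X -> _]big1 => [|t /fT ->]; last exact: ComplexField.Normc.normc0.
rewrite addr0; under [X in _ + X <= _ -> _]eq_bigr => t /fT ->.
  rewrite add0r; over.
set H := \sum_(t | t \notin _) normc (h t) => gf.
have BH : \sum_(j | j \notin jump_coords) `|coords h j| <= 2 * H.
  rewrite (eq_bigl (fun j => j.1 \notin jump_set f)); last by move=> j; rewrite inE.
  rewrite (big_coords _ (fun t => t \notin jump_set f)) mulr_sumr.
  by apply: ler_sum => t _; exact: coords_norm_le.
have signE : dotp jump_sign (coords h) = \sum_(t in jump_set f)
    (jump_sign (t, false) * complex.Re (h t) + jump_sign (t, true) * complex.Im (h t)).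
  rewrite -(big_coords (fun j => jump_sign j * coords h j) (fun t => t \in jump_set f)).
  rewrite /dotp [RHS]big_mkcond; apply: eq_bigr => j _.
  case: ifPn => // jT; rewrite jump_sign_supp ?mul0r//.
  by rewrite inE.
have : \sum_(t in jump_set f) normc (diff f t) + dotp jump_sign (coords h) <=
    \sum_(t in jump_set f) normc (diff f t + h t).
  rewrite signE -big_split /=; apply: ler_sum => t tT.
  by rewrite addrA; exact: normc_shift_jump.
have H0 : 0 <= H by apply: sumr_ge0 => t _; exact: normc_ge0.
(* Off the jumps the variation grows by [H]; on them it drops by at most [3/8 * (2 * H)]. The net
   gain is at least [H / 4], so [H = 0]. *)
move=> hf; have {}H0 : H = 0 by apply/eqP; rewrite eq_le H0 andbT; lra.
have B0 : \sum_(j | j \notin jump_coords) `|coords h j| = 0.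
  by apply/eqP; rewrite eq_le sumr_ge0// andbT; rewrite H0 mulr0 in BH.
have A0 : \sum_(j in jump_coords) `|coords h j| = 0.
  by apply/eqP; rewrite eq_le sumr_ge0// andbT; rewrite B0 mulr0 in AB.
have h0 t : h t = 0.
  have c0 j : coords h j = 0.
    have [jD|jD] := boolP (j \in jump_coords).
      by have /psumr_eq0P/(_ _ jD)/eqP := A0; rewrite normr_eq0 => /(_ _)/eqP ->.
    by have /psumr_eq0P/(_ _ jD)/eqP := B0; rewrite normr_eq0 => /(_ _)/eqP ->.
  have := c0 (t, false); have := c0 (t, true); rewrite /coords /=.
  by case: (h t) => a b /= -> ->.
have eP t : e t = e (ord_pred t).
  by apply/eqP; rewrite -subr_eq0; have := h0 t; rewrite [h t]ffunE => ->.
have eC t t' : e t = e t'.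
  suff e0 (s : 'I_N) : e s = e (Ordinal N0) by rewrite e0 [RHS]e0.
  case: s => m mN; elim: m mN => [|m IHm] mN; first by congr (e _); apply: val_inj.
  rewrite eP -(IHm (ltnW mN)); congr (e _); apply: val_inj => /=.
  by rewrite modnDr modn_small// ltnW.
(* [e] is constant by now, and the constraint at frequency 0 makes its sum vanish. *)
have := dfte (Ordinal N0) (or_intror erefl); rewrite /dft.
under eq_bigr => t _.
  rewrite (eC t (Ordinal N0)) /= mulr0 mul0r mul0r oppr0.
  rewrite (_ : expi 0 = 1); last by rewrite /expi cos0 sin0.
  rewrite mulr1; over.
rewrite sumr_const card_ord => /eqP; rewrite mulrn_eq0 eqn0Ngt N0 /= => /eqP e0.
apply/ffunP => t; apply/eqP; rewrite -subr_eq0.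
by have := eC t (Ordinal N0); rewrite e0 ffunE => ->.
Qed.

Lemma certified_exact_recovery : tv_exact_recovery f S.
Proof.
have ff : feasible f S f by [].
move=> g; split=> [[gS gmin]|->].
  by apply: feasible_total_variation => //; exact: gmin.
split=> // h hS; have /orP[//|hf] := le_total (total_variation f) (total_variation h).
by rewrite (feasible_total_variation hS hf).
Qed.

End Certificates.

End ExactRecovery.

(** * Failure probability *)

(** [1 - p] is the [n]-th root of [1 - tau], so [n] batches together have exactly the law of the
    given set; [tau <= n%:R * p] is Bernoulli's inequality. *)
Lemma batch_probability (R : realType) (tau : R) (n : nat) : 0 < tau < 1 -> (0 < n)%N ->
  exists p : R, [/\ 0 < p <= 1, 1 - (1 - p) ^+ n = tau & tau <= n%:R * p].
Proof.
move=> /andP[t0 t1] n0; have n0R : n%:R != 0 :> R by rewrite pnatr_eq0 -lt0n.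
pose x : R := (1 - tau) `^ (n%:R^-1).
have xn : x ^+ n = 1 - tau.
  rewrite -powR_mulrn ?powR_ge0// -powRrM mulVf// powRr1//; lra.
have x0 : 0 <= x by exact: powR_ge0.
have x1 : x < 1.
  rewrite ltNge; apply/negP => x1; have := exprn_ege1 n x1; rewrite xn; lra.
exists (1 - x); split; first by apply/andP; split; lra.
  by rewrite subKr xn; ring.
have : tau = 1 - x ^+ n by rewrite xn; ring.
move=> ->; elim: (n) => [|m IHm]; first by rewrite expr0 subrr mul0r.
have : x ^+ m <= 1 by rewrite exprn_ile1// ltW.
have : 0 <= x ^+ m by rewrite exprn_ge0.
rewrite exprS -natr1; move: IHm; set y := x ^+ m => IHm y0 y1.
have : 0 <= (1 - x) * (1 - y) by rewrite mulr_ge0// subr_ge0// ltW.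
lra.
Qed.

(** [exp (1/2) <= 1 + 1/2 + 1/2]. The bound absorbs the 1 lost in rounding the number of batches. *)
Lemma ln_nat_ge_half (R : realType) (N : nat) : (2 <= N)%N -> 1/2 <= ln N%:R :> R.
Proof.
move=> N2; have N0 : (0 : R) < N%:R by rewrite ltr0n (ltn_trans _ N2).
rewrite -ler_expR lnK ?posrE//; apply: le_trans (expR_le_quad (lexx _)) _.
have : 2 <= N%:R :> R by rewrite ler_nat.
lra.
Qed.

Section FailureProbability.
Variables (R : realType) (N : nat) (f : {ffun 'I_N -> R[i]}) (p lam : R).
Hypothesis N2 : (2 <= N)%N.
Hypothesis p01 : 0 < p <= 1.
Hypothesis lam0 : 0 < lam.
Hypothesis jumps : 400 * #|jump_coords f|%:R <= p * N%:R.

Let N0 : (0 < N)%N. Proof. exact: ltn_trans N2. Qed.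

Let N0R : (0 : R) < N%:R. Proof. by rewrite ltr0n. Qed.

Let card_jump_coords_le : #|jump_coords f|%:R <= 2 * N%:R :> R.
Proof.
rewrite -natrM ler_nat card_jump_coords leq_mul2l /=.
by rewrite (leq_trans (max_card _))// card_ord.
Qed.

(** Golfing from [v = 0] and [r = 1], with [G = 128 * N^3] so that [G * tolerance^2 = 2 * N]. Each
    initial [excess] is [exp (lam * (1/8 - 1/4))], and there are two for each of at most [2 * N]
    coordinates. *)
Lemma prob_not_certified n (q : 'I_N * bool -> R) :
  (forall j, j \notin jump_coords f -> q j = 0) ->
  dotp q q <= #|jump_coords f|%:R ->
  bmean (1 - (1 - p) ^+ n) (fun S => (~~ `[< certified f S q >])%:R) <=
  128 * N%:R ^+ 3 * expR (3 * lam) * (3/4) ^+ n + 4 * N%:R * expR (- (lam / 8)).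
Proof.
have G0 : 0 < 128 * N%:R ^+ 3 :> R by rewrite mulr_gt0 ?exprn_gt0 ?ltr0n.
(* Golfing assumes a nonempty support; without jumps the zero vector certifies. *)
move=> qD qq; have [D0|D0] := posnP #|jump_coords f|.
  rewrite (eq_bmean _ (G := fun=> 0)) => [|S]; last first.
    rewrite asboolT//; exists (fun=> 0); split.
    - by move=> h _; rewrite /dotp big1// => j _; rewrite mul0r.
    - by move=> j; rewrite (finset.cards0_eq D0) inE.
    - by move=> j _; rewrite addr0 normr0; lra.
  have h34 : 0 <= (3/4) ^+ n :> R by apply: exprn_ge0; rewrite divr_ge0.
  rewrite bmean_cst; apply: addr_ge0; last by rewrite mulr_ge0 ?expR_ge0// mulr_ge0.
  by apply: mulr_ge0.
have tol0 : 0 < tolerance R N by rewrite invr_gt0 mulr_gt0 ?ltr0n.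
have DG : #|jump_coords f|%:R <= 128 * N%:R ^+ 3 * tolerance R N ^+ 2.
  apply: le_trans card_jump_coords_le _.
  by rewrite le_eqVlt /tolerance; apply/orP; left; apply/eqP; field; rewrite gt_eqF.
have pI : 400 * #|jump_coords f|%:R <= p * #|'I_N|%:R by rewrite card_ord.
have qq1 : dotp q q <= 1 ^+ 2 * #|jump_coords f|%:R by rewrite expr1n mul1r.
apply: le_trans (prob_not_certifies (@fourier_tight R N) p01 lam0 D0 pI G0 tol0 DG
  n (fun=> 0) ltr01 qD qq1) _.
rewrite /golf_bound /growth expr1n !mulr1 [X in X + _]mulrC lerD2l.
have excessE j : excess lam (fun=> 0) 1 j = expR (- (lam / 8)).
  by rewrite /excess; congr expR; field.
have excessNE j : excess lam (\- (fun=> 0)) 1 j = expR (- (lam / 8)).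
  by rewrite /excess /= oppr0; congr expR; field.
under eq_bigr do rewrite excessE excessNE.
rewrite sumr_const -[X in X <= _]mulr_natl -mulr2n -[_ *+ 2]mulr_natl mulrA.
apply: ler_wpM2r; first exact: expR_ge0.
rewrite -natrM -natrM ler_nat.
apply: leq_trans (leq_mul (max_card _) (leqnn _)) _.
by rewrite card_prod card_ord card_bool -mulnA mulnC.
Qed.

(** A union bound over the sign vector and at most [2 * N] unit vectors, and
    [1 + 2 * N <= 3 * N]. *)
Lemma prob_not_recovered n :
  bmean (1 - (1 - p) ^+ n) (fun S => (~~ `[< tv_exact_recovery f S >])%:R) <=
  3 * N%:R * (128 * N%:R ^+ 3 * expR (3 * lam) * (3/4) ^+ n +
              4 * N%:R * expR (- (lam / 8))).
Proof.
set beta := (X in _ <= _ * X).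
have p_tau : 0 <= 1 - (1 - p) ^+ n <= 1.
  case/andP: p01 => /ltW p0 p1; rewrite subr_ge0 gerBl exprn_ge0 ?subr_ge0//.
  by rewrite exprn_ile1 ?subr_ge0// gerBl.
apply: (@le_trans _ _ (bmean (1 - (1 - p) ^+ n) (fun S =>
    (~~ `[< certified f S (jump_sign f) >])%:R +
    \sum_(j in jump_coords f) (~~ `[< certified f S (unit_vector R j) >])%:R))).
  apply: le_bmean => // S; set X := (X in _ <= _ + X).
  have X0 : 0 <= X by apply: sumr_ge0.
  have [cs|ncs] := pselect (certified f S (jump_sign f)); last first.
    rewrite [X in _ <= (~~ X)%:R + _]asboolF//=; apply: ler_wpDr => //.
    by rewrite lern1 leq_b1.
  have [cu|] := pselect (forall j, j \in jump_coords f -> certified f S (unit_vector R j)).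
    by rewrite asboolT ?addr_ge0//; exact: certified_exact_recovery.
  move=> /existsNP[j /not_implyP[jD ncu]]; apply: ler_wpDl => //.
  rewrite /X (bigD1 j)//= [X in _ <= (~~ X)%:R + _]asboolF//=.
  by apply: ler_wpDr; [exact: sumr_ge0|rewrite lern1 leq_b1].
rewrite bmeanD (bmean_sum _ (fun j => j \in jump_coords f)).
have sign_le := prob_not_certified n (@jump_sign_supp _ _ f) (dotp_jump_sign f).
have unit_le j : j \in jump_coords f -> bmean (1 - (1 - p) ^+ n)
    (fun S => (~~ `[< certified f S (unit_vector R j) >])%:R) <= beta.
  move=> jD; apply: prob_not_certified => [i iD|].
    by rewrite /unit_vector; case: eqP iD => // ->; rewrite jD.
  rewrite /dotp (bigD1 j)//= /unit_vector eqxx mulr1 big1 => [|i /negbTE ->].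
    by rewrite addr0 ler1n; apply/card_gt0P; exists j.
  by rewrite mulr0.
have beta0 : 0 <= beta.
  apply: le_trans sign_le; apply: sumr_ge0 => S _.
  by rewrite mulr_ge0// bweight_ge0.
apply: le_trans (lerD sign_le (ler_sum _ unit_le)) _.
rewrite sumr_const -[X in _ + X <= _]mulr_natl -/beta -[X in X + _]mul1r -mulrDl.
rewrite ler_wpM2r//; have : 1 <= N%:R :> R by rewrite ler1n.
have := card_jump_coords_le; lra.
Qed.

End FailureProbability.

(** As [(3/4)^n <= exp (- n / 4)], the first exponent is at most
    [24 (M + 2) - (25 M + 52) = - M - 4] times [ln N], and the second is [- M - 2] times it. This
    absorbs [N^4] and [N^2], leaving [384 + 12 = 396]. *)
Lemma failure_bound (R : realType) (M : R) (N n : nat) : (2 <= N)%N ->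
  4 * (25 * M + 52) * ln N%:R <= n%:R ->
  3 * N%:R * (128 * N%:R ^+ 3 * expR (3 * (8 * (M + 2) * ln N%:R)) * (3/4) ^+ n +
    4 * N%:R * expR (- (8 * (M + 2) * ln N%:R / 8))) <=
  396 * N%:R `^ (- M) :> R.
Proof.
move=> N2 nK; have N0 : 0 < N%:R :> R by rewrite ltr0n (ltn_trans _ N2).
rewrite /powR gt_eqF//; set L := ln _ in nK *.
have NE : N%:R = expR L by rewrite lnK ?posrE.
have e34 : (3/4) ^+ n <= expR (n%:R * - (1/4)) :> R.
  rewrite expRM_natl; apply: lerXn2r; rewrite ?nnegrE ?expR_ge0//.
  by apply: le_trans (expR_ge1Dx _); lra.
have decay : expR (3 * (8 * (M + 2) * L)) * (3/4) ^+ n <= expR (- M * L - 4 * L).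
  apply: le_trans (ler_wpM2l (expR_ge0 _) e34) _.
  by rewrite -expRD ler_expR; lra.
have -> : expR (- (8 * (M + 2) * L / 8)) = expR (- M * L - 2 * L).
  by congr expR; field.
have N4 : N%:R ^+ 4 * expR (- M * L - 4 * L) = expR (- M * L).
  by rewrite NE -expRM_natl -expRD; congr expR; ring.
have N2' : N%:R ^+ 2 * expR (- M * L - 2 * L) = expR (- M * L).
  by rewrite NE -expRM_natl -expRD; congr expR; ring.
have := ler_wpM2l (exprn_ge0 4 (ltW N0)) decay; rewrite N4.
move: N2'; set E2 := expR (_ - 2 * L); set e3 := expR (3 * _); set q := (3/4) ^+ n.
move=> E2E E3E.
rewrite (_ : _ * _ = 384 * (N%:R ^+ 4 * (e3 * q)) + 12 * (N%:R ^+ 2 * E2)); last by ring.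
rewrite E2E; lra.
Qed.

Unset Implicit Arguments.

Theorem corollary1p4 (R : realType) (M : R) (hM : 0 < M) :
  exists alpha C : R, [/\ 0 < alpha, 0 < C &
    forall (N : nat) (tau : R) (f : {ffun 'I_N -> R[i]})
      (d : measure_display) (T : measurableType d) (P : probability T R)
      (Omega : T -> {set 'I_N}),
      (2 <= N)%N -> 0 < tau -> tau < 1 ->
      bernoulli_random_set P tau Omega ->
      #|jump_set f|%:R <= alpha * (ln N%:R)^-1 * (tau * N%:R) ->
      ((1 - C * N%:R `^ (- M))%:E
         <= P [set w | tv_exact_recovery f (Omega w)])%E].
Proof.
pose K := 4 * (25 * M + 52).
have K0 : 0 < K by rewrite /K; lra.
have K2 : 0 < K + 2 by lra.
have M2 : 0 < M + 2 by lra.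
have n800 : 0 < 800 :> R by rewrite ltr0n.
(* [failure_bound] asks for [K * ln N] batches, and rounding up gives at most [(K + 2) * ln N]. The
   [800] is the [400] of the sampling condition times the two real coordinates of a jump. *)
exists (800 * (K + 2))^-1, 396; split.
- by rewrite invr_gt0 mulr_gt0.
- by rewrite ltr0n.
move=> N tau f d T P Omega N2 t0 t1 OmegaP jumps.
have N0 : 0 < N%:R :> R by rewrite ltr0n (ltn_trans _ N2).
have L12 := ln_nat_ge_half R N2; set L := ln _ in jumps L12 *.
have L0 : 0 < L by lra.
pose n := (Num.truncn (K * L)).+1.
have nK : K * L <= n%:R by rewrite ltW// truncnS_gt.
have nL : n%:R <= (K + 2) * L.
  have : (Num.truncn (K * L))%:R <= K * L by rewrite truncn_le mulr_ge0 ?ltW.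
  by rewrite /n -natr1; lra.
have [|p [p01 ptau taup]] := @batch_probability R tau n _ isT; first by rewrite t0 t1.
have sampling : 400 * #|jump_coords f|%:R <= p * N%:R.
  have KL0 : 0 < (K + 2) * L by rewrite mulr_gt0.
  have tp : tau <= (K + 2) * L * p.
    by apply: le_trans taup _; apply: ler_wpM2r => //; case/andP: p01 => /ltW.
  have tpN : tau * N%:R <= (K + 2) * L * p * N%:R by rewrite ler_pM2r.
  rewrite card_jump_coords natrM -(ler_pM2l KL0) [X in _ <= X]mulrA.
  apply: le_trans tpN; move: jumps; set J := #|_|%:R.
  have -> : (800 * (K + 2))^-1 * L^-1 * (tau * N%:R) =
      tau * N%:R / (800 * ((K + 2) * L)) by rewrite !invfM; ring.
  rewrite ler_pdivlMr; last by rewrite mulr_gt0.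
  by have -> : J * (800 * ((K + 2) * L)) = (K + 2) * L * (400 * (2%N%:R * J)) by ring.
have lam0 : 0 < 8 * (M + 2) * L by rewrite !mulr_gt0 ?ltr0n.
have fail := prob_not_recovered N2 p01 lam0 sampling n.
have {}fail := le_trans fail (failure_bound N2 nK).
rewrite (prob_random_set OmegaP) lee_fin lerBlDr -lerBlDl.
(* The indicators of recovery and of failure add up to 1. *)
apply: le_trans fail; rewrite ptau lerBlDl -bmeanD -[X in X <= _](bmean_cst 'I_N tau).
apply: le_bmean => [|S]; first by rewrite !ltW.
by case: (`[< _ >]); rewrite /= ?addr0 ?add0r.
Qed.
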